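(* Let $T_0=\{n/3^k: n\in\mathbf{N} \text{ stable},\ k\in\mathbf{Z}_{\ge0},\ \|n\|=3k+2\}$ and $K=\overline{T_0}$ (closure in $\mathbf{R}$). Then $K$ is an arithmetic compact set with module $\mu=3$ and ratio $\rho=3$, and its stability gauge coincides with the stable complexity: $\|n\|_K=\|n\|_{\mathrm{st}}$ for all $n\in\mathbf{N}$.
   Context: The complexity $\|n\|$ of $n\in\mathbf{N}$ is the least number of occurrences of the symbol $1$ in an expression equal to $n$ built only from $1$, $+$, $\times$ and parentheses. A natural number $n$ is stable if $\|3^k n\|=\|n\|+3k$ for all $k\ge0$. (It is known that for each $n$ there is $a\ge0$ with $3^a n$ stable.) The stable complexity is $\|n\|_{\mathrm{st}}=\|3^a n\|-3a$ for any $a$ with $3^a n$ stable. For $A\subset\mathbf{R}$, $A'$ is the derived set, $A^{(0)}=A$, $A^{(n+1)}=(A^{(n)})'$. The reverse usual order is $x\preccurlyeq y$ iff $x\ge y$; for a set $L$ well ordered by $\preccurlyeq$, $L[\alpha]$ is its element in position $\alpha$ (from $0$). A self-similar compact set of ratio $\rho>1$ and module $\mu\in\mathbf{N}$ is a compact $K\subset[0,\infty)$ with $\rho K^{(\mu)}=K$, well ordered by $\preccurlyeq$, of order type $\omega^\omega+1$; put $T_u(K)=K^{(u)}\setminus K^{(u+1)}$. $K$ is quasi-arithmetic if $\rho\ge2$ is an integer and there is $\kappa\colon\mathbf{N}\setminus\rho\mathbf{N}\to\mathbf{Z}_{\ge0}$ with $K\setminus\{0\}=\{m/\rho^k:\rho\nmid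 m,\ k\ge\kappa(m)\}$. For $n\in\mathbf{N}$ choose $\ell\in\mathbf{Z}$, $u\ge0$ with $n/\rho^\ell\in T_u(K)$; the stability gauge is $\|n\|_K=\ell\mu+d-u$ (independent of the choice), with the constant $d$ chosen so that $\|1\|_K=0$. A quasi-arithmetic $K$ is an arithmetic compact if for every ordinal $0\le\alpha<\omega^\omega$ and every $u\ge0$, writing $T_{u+1}(K)[\alpha]=n/\rho^k$ with $\rho\nmid n$, the sets $\{T_u(K)[\omega\alpha+r]: r\ge0\}$ and $\{b(a\rho^r+1)/\rho^{r+k}: a,b\in\mathbf{N},\ n=ab,\ \|n\|_K=\|a\|_K+\|b\|_K,\ r\ge0\}$ have finite symmetric difference. *)

(* Defs.v *)
From Stdlib Require Import Reals Lra Lia ZArith Arith List.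
From Stdlib Require Import Classical ClassicalEpsilon.
From Stdlib Require Export Rtopology.
Import ListNotations.
Open Scope R_scope.

Inductive iexpr : Type :=
| EOne : iexpr
| EPlus : iexpr -> iexpr -> iexpr
| ETimes : iexpr -> iexpr -> iexpr.

Fixpoint ieval (e : iexpr) : nat :=
  match e with
  | EOne => 1
  | EPlus a b => ieval a + ieval b
  | ETimes a b => ieval a * ieval b
  end%nat.

Fixpoint iones (e : iexpr) : nat :=
  match e with
  | EOne => 1
  | EPlus a b => iones a + iones b
  | ETimes a b => iones a + iones b
  end%nat.

Definition is_complexity (n c : nat) : Prop :=
  (exists e, ieval e = n /\ iones e = c) /\
  (forall e, ieval e = n -> (c <= iones e)%nat).

(* ||n|| (meaningful for n >= 1) *)
Definition cpx (n : nat) : nat :=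
  epsilon (inhabits 0%nat) (fun c => is_complexity n c).

Definition stable (n : nat) : Prop :=
  (1 <= n)%nat /\ forall k : nat, cpx (3 ^ k * n) = (cpx n + 3 * k)%nat.

Definition cpx_st (n : nat) : Z :=
  epsilon (inhabits 0%Z)
    (fun v => exists a : nat, stable (3 ^ a * n) /\
                v = (Z.of_nat (cpx (3 ^ a * n)) - 3 * Z.of_nat a)%Z).

Definition closure_R (A : R -> Prop) : R -> Prop :=
  fun x => forall eps, 0 < eps -> exists y, A y /\ Rabs (y - x) < eps.

Definition derived (A : R -> Prop) : R -> Prop :=
  fun x => forall eps, 0 < eps -> exists y, A y /\ y <> x /\ Rabs (y - x) < eps.

Fixpoint derived_n (A : R -> Prop) (n : nat) : R -> Prop :=
  match n with
  | O => A
  | S m => derived (derived_n A m)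
  end.

Definition T_layer (K : R -> Prop) (u : nat) : R -> Prop :=
  fun x => derived_n K u x /\ ~ derived_n K (S u) x.

(* A list [c_0; c_1; ...; c_m] represents omega^m c_m + ... + omega c_1 + c_0.
   It is normal when it is empty or its last coefficient is nonzero;
   normal lists are in bijection with ordinals < omega^omega. *)
Definition ord_ok (a : list nat) : Prop := a = [] \/ last a 0%nat <> 0%nat.

Fixpoint lex_lt (a b : list nat) : Prop :=
  match a, b with
  | x :: a', y :: b' => (x < y)%nat \/ (x = y /\ lex_lt a' b')
  | _, _ => False
  end.

Definition ord_lt (a b : list nat) : Prop :=
  (length a < length b)%nat \/
  (length a = length b /\ lex_lt (rev a) (rev b)).

Definition omega_mul_add (alpha : list nat) (r : nat) : list nat :=
  match alpha with
  | [] => match r with O => [] | _ => [r] end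
  | _ => r :: alpha
  end.

(* ordinals <= omega^omega : Some a for a < omega^omega, None for omega^omega *)
Definition ordw_ok (o : option (list nat)) : Prop :=
  match o with Some a => ord_ok a | None => True end.

Definition ordw_lt (o1 o2 : option (list nat)) : Prop :=
  match o1, o2 with
  | Some a, Some b => ord_lt a b
  | Some _, None => True
  | None, _ => False
  end.

(* Sets of reals well ordered by the reverse order  x ≼ y <-> x >= y   *)

Definition rev_well_ordered (L : R -> Prop) : Prop :=
  forall S : R -> Prop, (forall x, S x -> L x) -> (exists x, S x) ->
    exists m, S m /\ forall y, S y -> y <= m.

Definition order_type_ww_plus_1 (L : R -> Prop) : Prop :=
  exists f : option (list nat) -> R,
    (forall o, ordw_ok o -> L (f o)) /\
    (forall x, L x -> exists o, ordw_ok o /\ f o = x) /\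
    (forall o1 o2, ordw_ok o1 -> ordw_ok o2 -> ordw_lt o1 o2 -> f o2 < f o1).

(* L[alpha] = x  (alpha < omega^omega): x is in L and the set of elements
   of L strictly ≼-before x (i.e. greater than x) has order type alpha *)
Definition at_position (L : R -> Prop) (alpha : list nat) (x : R) : Prop :=
  L x /\
  exists g : list nat -> R,
    (forall b, ord_ok b -> ord_lt b alpha -> L (g b) /\ x < g b) /\
    (forall y, L y -> x < y -> exists b, ord_ok b /\ ord_lt b alpha /\ g b = y) /\
    (forall b c, ord_ok b -> ord_ok c -> ord_lt b c -> ord_lt c alpha ->
       g c < g b).

Definition self_similar_compact (K : R -> Prop) (rho : R) (mu : nat) : Prop :=
  1 < rho /\ (1 <= mu)%nat /\
  compact K /\
  (forall x, K x -> 0 <= x) /\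
  (forall x, K x <-> exists y, derived_n K mu y /\ x = rho * y) /\
  rev_well_ordered K /\
  order_type_ww_plus_1 K.

Definition quasi_arithmetic (K : R -> Prop) (rho mu : nat) : Prop :=
  self_similar_compact K (INR rho) mu /\ (2 <= rho)%nat /\
  exists kappa : nat -> nat,
    forall x, (K x /\ x <> 0) <->
      exists m k : nat, (1 <= m)%nat /\ ~ Nat.divide rho m /\
        (kappa m <= k)%nat /\ x = INR m / INR rho ^ k.

Definition gauge_raw (K : R -> Prop) (rho : R) (mu n : nat) : Z :=
  let p := epsilon (inhabits (0%Z, 0%nat))
             (fun p : Z * nat =>
                T_layer K (snd p) (INR n / powerRZ rho (fst p))) in
  (fst p * Z.of_nat mu - Z.of_nat (snd p))%Z.

(* stability gauge ||n||_K = l*mu + d - u, with d fixed by ||1||_K = 0 *)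
Definition gauge (K : R -> Prop) (rho : R) (mu n : nat) : Z :=
  (gauge_raw K rho mu n - gauge_raw K rho mu 1)%Z.

Definition finite_R (S : R -> Prop) : Prop :=
  exists l : list R, forall x, S x -> In x l.

Definition arithmetic_compact (K : R -> Prop) (rho mu : nat) : Prop :=
  quasi_arithmetic K rho mu /\
  forall (alpha : list nat) (u : nat), ord_ok alpha ->
  forall (x : R) (n k : nat),
    at_position (T_layer K (S u)) alpha x ->
    (1 <= n)%nat -> ~ Nat.divide rho n -> x = INR n / INR rho ^ k ->
    let S1 := fun y => exists r : nat,
                at_position (T_layer K u) (omega_mul_add alpha r) y in
    let S2 := fun y => exists a b r : nat,
                (1 <= a)%nat /\ (1 <= b)%nat /\ n = (a * b)%nat /\
                gauge K (INR rho) mu n =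
                  (gauge K (INR rho) mu a + gauge K (INR rho) mu b)%Z /\
                y = INR b * (INR a * INR rho ^ r + 1) / INR rho ^ (r + k) in
    finite_R (fun y => (S1 y /\ ~ S2 y) \/ (S2 y /\ ~ S1 y)).

Definition T0 : R -> Prop :=
  fun x => exists n k : nat, stable n /\ cpx n = (3 * k + 2)%nat /\
                              x = INR n / 3 ^ k.

Definition K0 : R -> Prop := closure_R T0.

(* Main.v *)
Require Import Defs.
From Stdlib Require Import Reals Lra Lia ZArith Arith List.
From Stdlib Require Import Classical ClassicalEpsilon IndefiniteDescription.
Import ListNotations.
Open Scope R_scope.

(* For a positive triadic rational x = n / 3^k the integer sigma(x) = ||n||_st - 3k
   is well defined.  Everything follows from one compactness statement: a
   sequence in {sigma <= c} bounded away from 0 has a subsequence which is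
   constant, or strictly decreasing to a point l with sigma(l) <= c - 1; in the
   second case, if sigma(l) = c - 1, its terms are b (a + 3^-r) with l = a b and
   sigma(l) = sigma(a) + sigma(b).  This is proved by induction on the defect
   c - 3 log_3 x: an optimal expression of x is, up to a power of 3, either a
   product of two factors of smaller defect, or a sum A + B in which B stays
   bounded along the sequence, so that A / 3^p has cost at most c - 1.
   Adding a single digit 1 far to the right raises sigma by at most 1, and by
   the compactness statement exactly by 1 eventually.  Hence
   K^(u) = {0} u {sigma <= 2 - u}, the layers are T_u(K) = {sigma = 2 - u}, and
   the elements of K^(u) below a point X and above the next element of K^(u+1)
   form a sequence decreasing to that element, from which the order type and
   all positions can be read off in Cantor normal form. *)

(** The relation sigma(x) <= c is encoded by an expression at some scale ([stle]). In this form it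
    is monotone in c and compatible with products, and it presupposes nothing about stable numbers:
    the bound n ^ 3 <= 3 ^ ones gives x ^ 3 <= 3 ^ c, so each x has a least cost, and stability
    means that this least cost is attained. Logarithms are avoided by cubing: the defect is measured
    by the ratio of [p3 c] to a lower bound h of x ^ 3. The obstacle is that the defect is a real
    number, so an induction on it needs a fixed quantum. Splitting a product helps only if each
    factor has a defect bounded away from 0. Equality in n ^ 3 <= 3 ^ ones occurs only at powers of
    3; these are absorbed in the scale, and every other value loses at least the factor 9 / 8. In a
    sum A + B with B <= A one has x <= 2 A / 3 ^ p, hence x ^ 3 <= 8 * 3 ^ (c - ones of B). A lower
    bound on x therefore bounds the cost of B, which is why B takes finitely many values along a
    sequence. *)

Definition p3 (z : Z) : R := powerRZ 3 z.

Lemma p3_pos z : 0 < p3 z.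
Proof. apply powerRZ_lt; lra. Qed.

Lemma p3_add a b : p3 (a + b) = p3 a * p3 b.
Proof. apply powerRZ_add; lra. Qed.

Lemma p3_0 : p3 0 = 1.
Proof. reflexivity. Qed.

Lemma p3_1 : p3 1 = 3.
Proof. unfold p3; simpl; lra. Qed.

Lemma p3_nat k : p3 (Z.of_nat k) = 3 ^ k.
Proof. symmetry; apply pow_powerRZ. Qed.

Lemma p3_opp a : p3 (- a) * p3 a = 1.
Proof. rewrite <- p3_add, Z.add_opp_diag_l; reflexivity. Qed.

Lemma p3_opp_nat k : p3 (- Z.of_nat k) = / 3 ^ k.
Proof. unfold p3; rewrite powerRZ_neg', <- pow_powerRZ; reflexivity. Qed.

Lemma p3_triple a : p3 (3 * a) = p3 a ^ 3.
Proof. replace (3 * a)%Z with (a + (a + a))%Z by lia. rewrite !p3_add; ring. Qed.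

Lemma p3_ge1 a : (0 <= a)%Z -> 1 <= p3 a.
Proof.
  intros Ha; rewrite <- (Z2Nat.id a Ha), p3_nat; apply pow_R1_Rle; lra.
Qed.

Lemma p3_le a b : (a <= b)%Z -> p3 a <= p3 b.
Proof.
  intros H; replace b with (a + (b - a))%Z by lia; rewrite p3_add.
  pose proof (p3_pos a); assert (1 <= p3 (b - a)) by (apply p3_ge1; lia); nra.
Qed.

Lemma p3_lt a b : (a < b)%Z -> p3 a < p3 b.
Proof.
  intros H; replace b with ((b - 1) + 1)%Z by lia; rewrite p3_add, p3_1.
  assert (p3 a <= p3 (b - 1)) by (apply p3_le; lia).
  pose proof (p3_pos a); lra.
Qed.

Lemma p3_le_inv a b : p3 a <= p3 b -> (a <= b)%Z.
Proof.
  intros H; destruct (Z_le_gt_dec a b) as [|C]; auto.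
  assert (p3 b < p3 a) by (apply p3_lt; lia); lra.
Qed.

Lemma p3_lt_inv a b : p3 a < p3 b -> (a < b)%Z.
Proof.
  intros H; destruct (Z_lt_ge_dec a b) as [|C]; auto.
  assert (p3 b <= p3 a) by (apply p3_le; lia); lra.
Qed.

Lemma p3_small eps : 0 < eps -> exists K : nat, p3 (- Z.of_nat K) < eps.
Proof.
  intros He.
  destruct (pow_lt_1_zero (/ 3)) with (y := eps) as [N HN]; auto.
  { rewrite Rabs_right; lra. }
  exists N; rewrite p3_opp_nat, <- pow_inv.
  specialize (HN N (Nat.le_refl N)).
  rewrite Rabs_right in HN; auto.
  apply Rle_ge, pow_le; lra.
Qed.

Lemma cube_le x y : 0 <= x -> x <= y -> x ^ 3 <= y ^ 3.
Proof. intros; apply pow_incr; lra. Qed.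

Lemma cube_le_inv x y : 0 <= y -> x ^ 3 <= y ^ 3 -> x <= y.
Proof.
  intros Hy H; apply Rnot_lt_le; intros C.
  assert (y ^ 3 < x ^ 3) by (assert (y * y < x * x) by nra; simpl; nra).
  lra.
Qed.

(** * The cubic bound on the value of an expression *)

Lemma ieval_pos e : (1 <= ieval e)%nat.
Proof. induction e; simpl; nia. Qed.

Lemma iones_pos e : (1 <= iones e)%nat.
Proof. induction e; simpl; lia. Qed.

Lemma ieval_INR_pos e : 1 <= INR (ieval e).
Proof. apply (le_INR 1), ieval_pos. Qed.

Lemma pow3_gt0 k : (0 < 3 ^ k)%nat.
Proof. apply Nat.neq_0_lt_0, Nat.pow_nonzero; lia. Qed.

Lemma ones_ge2 e : (2 <= ieval e)%nat -> (9 <= 3 ^ iones e)%nat.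
Proof.
  intros H; assert (2 <= iones e)%nat.
  { destruct e; simpl in *; [lia | |].
    - pose proof (iones_pos e1); pose proof (iones_pos e2); lia.
    - pose proof (iones_pos e1); pose proof (iones_pos e2); lia. }
  change 9%nat with (3 ^ 2)%nat; apply Nat.pow_le_mono_r; lia.
Qed.

(* The extremal case is [ieval e = 2 * 3 ^ k], [iones e = 3 * k + 2]. *)
Lemma ieval_bound e :
  (ieval e ^ 3 <= 3 ^ iones e)%nat /\
  ((exists j, ieval e = 3 ^ j)%nat \/ (9 * ieval e ^ 3 <= 8 * 3 ^ iones e)%nat).
Proof.
  (* The cubic bounds alone are too weak for small summands: a = 1 would give only 1 <= c. The extra
     hypotheses record that an expression has at least one occurrence of 1, and at least two once
     its value is 2 or more. The sum 1 + 1 attains 9 * 2 ^ 3 = 8 * 9, and 1 + 2 is the one case that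
     falls under the powers of 3. *)
  assert (Hplus : forall a b c d : nat, (1 <= a -> a <= b -> a ^ 3 <= c -> b ^ 3 <= d -> 3 <= c -> 3 <= d ->
    (2 <= a -> 9 <= c) -> (2 <= b -> 9 <= d) ->
    (a + b) ^ 3 <= c * d /\ ((exists j, a + b = 3 ^ j) \/ 9 * (a + b) ^ 3 <= 8 * (c * d)))%nat).
  { intros a b c d Ha Hab Hc Hd Hc3 Hd3 Hc9 Hd9.
    destruct (Nat.eq_dec a 1) as [->|Ha1].
    - destruct (Nat.eq_dec b 1) as [->|Hb1].
      { assert (9 <= c * d)%nat by nia. split; [simpl; lia | right; simpl; lia]. }
      destruct (Nat.eq_dec b 2) as [->|Hb2].
      { assert (27 <= c * d)%nat by nia. split; [simpl; lia | left; exists 1%nat; reflexivity]. }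
      assert (H : (9 * (1 + b) ^ 3 <= 24 * b ^ 3)%nat).
      { assert (Hq : (exists k, b = 3 + k)%nat) by (exists (b - 3)%nat; lia).
        destruct Hq as [k ->]; simpl; ring_simplify; nia. }
      assert (3 * d <= c * d)%nat by nia. split; [ | right]; lia.
    - destruct (Nat.eq_dec a 2) as [->|Ha2].
      + assert (H : (9 * (2 + b) ^ 3 <= 72 * b ^ 3)%nat).
        { assert (Hq : (exists k, b = 2 + k)%nat) by (exists (b - 2)%nat; lia).
          destruct Hq as [k ->]; simpl; ring_simplify; nia. }
        assert (9 * d <= c * d)%nat by (apply Nat.mul_le_mono_r; lia). split; [ | right]; lia.
      + assert (H : (3 * (a + b) <= 2 * (a * b))%nat) by nia.
        assert (H3 : ((3 * (a + b)) ^ 3 <= (2 * (a * b)) ^ 3)%nat) by (apply Nat.pow_le_mono_l; auto).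
        rewrite !Nat.pow_mul_l in H3.
        assert (a ^ 3 * b ^ 3 <= c * d)%nat by (apply Nat.mul_le_mono; auto).
        change (3 ^ 3)%nat with 27%nat in H3; change (2 ^ 3)%nat with 8%nat in H3.
        split; [ | right]; lia. }
  assert (Hge3 : forall e, (3 <= 3 ^ iones e)%nat).
  { intros e'; change 3%nat with (3 ^ 1)%nat at 1; apply Nat.pow_le_mono_r; [lia | apply iones_pos]. }
  induction e as [|a [IHa IHa'] b [IHb IHb']|a [IHa IHa'] b [IHb IHb']].
  - split; [simpl; lia | left; exists 0%nat; reflexivity].
  - cbn [ieval iones]; rewrite Nat.pow_add_r.
    destruct (Nat.le_ge_cases (ieval a) (ieval b)).
    + apply Hplus; auto using ones_ge2, ieval_pos.
    + rewrite (Nat.add_comm (ieval a)), (Nat.mul_comm (3 ^ iones a)).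
      apply Hplus; auto using ones_ge2, ieval_pos.
  - cbn [ieval iones]; rewrite Nat.pow_add_r, Nat.pow_mul_l.
    split; [apply Nat.mul_le_mono; auto|].
    destruct IHa' as [[i Hi]|Ha'].
    + destruct IHb' as [[j Hj]|Hb'].
      * left; exists (i + j)%nat; rewrite Nat.pow_add_r; congruence.
      * right. assert (ieval a ^ 3 * (9 * ieval b ^ 3) <= 3 ^ iones a * (8 * 3 ^ iones b))%nat
          by (apply Nat.mul_le_mono; auto). lia.
    + right. assert ((9 * ieval a ^ 3) * ieval b ^ 3 <= (8 * 3 ^ iones a) * 3 ^ iones b)%nat
          by (apply Nat.mul_le_mono; auto). lia.
Qed.

Lemma ieval_cube_le e : INR (ieval e) ^ 3 <= p3 (Z.of_nat (iones e)).
Proof.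
  rewrite p3_nat, <- pow_INR.
  replace 3 with (INR 3) by (simpl; lra). rewrite <- pow_INR.
  apply le_INR, ieval_bound.
Qed.

Lemma ieval_cube_le_sharp e :
  (exists j, ieval e = (3 ^ j)%nat) \/
  9 / 8 * INR (ieval e) ^ 3 <= p3 (Z.of_nat (iones e)).
Proof.
  destruct (ieval_bound e) as [_ [H|H]]; auto. right.
  apply le_INR in H. rewrite !mult_INR, !pow_INR in H. rewrite p3_nat.
  replace (INR 3) with 3 in H by (simpl; lra).
  replace (INR 9) with 9 in H by (simpl; lra).
  replace (INR 8) with 8 in H by (simpl; lra). lra.
Qed.

(** * Stable cost of positive triadic rationals *)

Fixpoint scale3 (j : nat) (e : iexpr) : iexpr :=
  match j with
  | O => e
  | S j' => ETimes (EPlus EOne (EPlus EOne EOne)) (scale3 j' e)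
  end.

Lemma ieval_scale3 j e : ieval (scale3 j e) = (3 ^ j * ieval e)%nat.
Proof. induction j as [|j IH]; simpl; [lia | rewrite IH; simpl; lia]. Qed.

Lemma iones_scale3 j e : iones (scale3 j e) = (3 * j + iones e)%nat.
Proof. induction j as [|j IH]; simpl; [lia | rewrite IH; simpl; lia]. Qed.

Lemma INR_pow3 k : INR (3 ^ k) = p3 (Z.of_nat k).
Proof. rewrite pow_INR, p3_nat; replace (INR 3) with 3 by (simpl; lra); reflexivity. Qed.

(* [stle c x]: the positive triadic rational [x = n / 3 ^ k] satisfies
   [||n||_st - 3 * k <= c]. *)
Definition stle (c : Z) (x : R) : Prop :=
  exists (e : iexpr) (k : Z),
    x = INR (ieval e) * p3 (- k) /\ (Z.of_nat (iones e) <= 3 * k + c)%Z.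

Definition st_eq (c : Z) (x : R) : Prop := stle c x /\ ~ stle (c - 1) x.

Lemma stle_weaken c d x : (c <= d)%Z -> stle c x -> stle d x.
Proof. intros H (e & k & Hx & Hc); exists e, k; split; auto; lia. Qed.

Lemma stle_pos c x : stle c x -> 0 < x.
Proof.
  intros (e & k & -> & _).
  pose proof (ieval_INR_pos e); pose proof (p3_pos (- k)); nra.
Qed.

Lemma stle_cube c x : stle c x -> x ^ 3 <= p3 c.
Proof.
  intros (e & k & -> & Hc).
  rewrite Rpow_mult_distr, <- p3_triple.
  apply Rle_trans with (p3 (3 * k + c) * p3 (3 * - k)).
  - apply Rmult_le_compat_r; [left; apply p3_pos|].
    eapply Rle_trans; [apply ieval_cube_le | apply p3_le; auto].
  - rewrite <- p3_add; right; f_equal; lia.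
Qed.

Lemma stle_shift j c x : stle c x -> stle (c + 3 * j) (x * p3 j).
Proof.
  intros (e & k & -> & Hc); exists e, (k - j)%Z; split; [|lia].
  replace (- (k - j))%Z with (- k + j)%Z by lia; rewrite p3_add; ring.
Qed.

Lemma stle_mul c d x y : stle c x -> stle d y -> stle (c + d) (x * y).
Proof.
  intros (e & k & -> & Hc) (f & l & -> & Hd); exists (ETimes e f), (k + l)%Z; split.
  - cbn [ieval]; rewrite mult_INR. replace (- (k + l))%Z with (- k + - l)%Z by lia.
    rewrite p3_add; ring.
  - cbn [iones]; lia.
Qed.

(** Multiplying by [1 + (1 + 1)] costs 3, exactly what one more factor 3 in the denominator allows.
    This leads from the stable cost back to genuine expressions of integers. *)
Lemma stle_large c x : stle c x -> exists k0 : nat, forall k : nat, (k0 <= k)%nat ->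
  exists e, INR (ieval e) = x * p3 (Z.of_nat k) /\ (Z.of_nat (iones e) <= 3 * Z.of_nat k + c)%Z.
Proof.
  intros (e & k & -> & Hc). exists (Z.to_nat k); intros m Hm.
  exists (scale3 (Z.to_nat (Z.of_nat m - k)) e); split.
  - rewrite ieval_scale3, mult_INR, INR_pow3, Z2Nat.id by lia.
    rewrite Rmult_assoc, <- p3_add, Rmult_comm; do 2 f_equal; lia.
  - rewrite iones_scale3; lia.
Qed.

Lemma stle_p3 j : stle (3 * j) (p3 j).
Proof.
  (* The unit is written as 3 / 3: the expression [EOne] would cost 1, while the stable cost of 1 is
     0. *)
  exists (EPlus EOne (EPlus EOne EOne)), (1 - j)%Z; split; [|cbn [iones]; lia].
  cbn [ieval]; simpl INR. replace (- (1 - j))%Z with (j + - (1))%Z by lia.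
  rewrite p3_add; pose proof (p3_opp 1) as E; rewrite p3_1 in E.
  transitivity (p3 j * (p3 (- (1)) * 3)); [rewrite E|]; ring.
Qed.

Lemma stle_1 : stle 0 1.
Proof. apply (stle_p3 0). Qed.

(* The scale must be large: [||2||_st = 2] although [||1||_st = 0]. *)
Lemma stle_add_p3 c x : stle c x ->
  exists r0 : nat, forall r : nat, (r0 <= r)%nat -> stle (c + 1) (x + p3 (- Z.of_nat r)).
Proof.
  intros H; destruct (stle_large _ _ H) as [r0 Hr]; exists r0; intros r Hle.
  destruct (Hr r Hle) as (e & He & Hc).
  exists (EPlus e EOne), (Z.of_nat r); split; [|cbn [iones]; lia].
  cbn [ieval]; rewrite plus_INR, He; simpl (INR 1).
  rewrite Rmult_plus_distr_r, Rmult_assoc, (Rmult_comm (p3 (Z.of_nat r))), p3_opp; ring.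
Qed.

(** By [stle_cube] the admissible costs of a fixed x are bounded below, so a descent from c stops at
    a least one. *)
Lemma st_eq_exists c x : stle c x -> exists d, (d <= c)%Z /\ st_eq d x.
Proof.
  intros H. pose proof (stle_pos _ _ H) as Hx.
  assert (Hlow : exists K : nat, ~ stle (- Z.of_nat K) x).
  { destruct (p3_small (x ^ 3)) as [K HK]; [apply pow_lt; auto|].
    exists K; intros C; apply stle_cube in C; lra. }
  destruct Hlow as [K HK].
  assert (G : forall m : nat, stle (- Z.of_nat K + Z.of_nat m) x ->
    exists d, (d <= - Z.of_nat K + Z.of_nat m)%Z /\ st_eq d x).
  { induction m as [|m IH]; intros Hm.
    - exfalso; apply HK; replace (- Z.of_nat K)%Z with (- Z.of_nat K + Z.of_nat 0)%Z by lia; auto.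
    - destruct (classic (stle (- Z.of_nat K + Z.of_nat m) x)) as [C|C].
      + destruct (IH C) as (d & ? & ?); exists d; split; auto; lia.
      + eexists; split; [apply Z.le_refl|]; split; auto.
        replace (- Z.of_nat K + Z.of_nat (S m) - 1)%Z with (- Z.of_nat K + Z.of_nat m)%Z by lia; auto. }
  destruct (Z_le_gt_dec (- Z.of_nat K) c) as [Hc|Hc].
  - destruct (G (Z.to_nat (c + Z.of_nat K))) as (d & ? & ?).
    + rewrite Z2Nat.id by lia. replace (- Z.of_nat K + (c + Z.of_nat K))%Z with c by lia; auto.
    + exists d; split; auto; lia.
  - exfalso; apply HK; eapply stle_weaken; [|apply H]; lia.
Qed.

Lemma st_eq_le c d x : st_eq c x -> stle d x -> (c <= d)%Z.
Proof.
  intros [_ H] Hd; destruct (Z_le_gt_dec c d); auto.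
  exfalso; apply H; eapply stle_weaken; [|apply Hd]; lia.
Qed.

Lemma st_eq_unique c d x : st_eq c x -> st_eq d x -> c = d.
Proof.
  intros Hc Hd; apply Z.le_antisymm; eapply st_eq_le; eauto; [apply Hd | apply Hc].
Qed.

Lemma st_eq_shift j c x : st_eq c x -> st_eq (c + 3 * j) (x * p3 j).
Proof.
  intros [H H']; split; [apply stle_shift; auto|].
  intros C; apply H', (stle_weaken (c + 3 * j - 1 + 3 * - j)); [lia|].
  replace x with (x * p3 j * p3 (- j)); [apply stle_shift; auto|].
  rewrite Rmult_assoc, (Rmult_comm (p3 j)), p3_opp; ring.
Qed.

(** * Accumulation of the costs *)

Definition extraction (phi : nat -> nat) : Prop := forall i, (phi i < phi (S i))%nat.

Lemma extraction_lt phi : extraction phi -> forall i j, (i < j)%nat -> (phi i < phi j)%nat.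
Proof.
  intros H i j Hij; induction Hij as [|j Hij IH]; [apply H|].
  specialize (H j); lia.
Qed.

Lemma extraction_ge phi : extraction phi -> forall i, (i <= phi i)%nat.
Proof. intros H i; induction i as [|i IH]; [lia|]; specialize (H i); lia. Qed.

Lemma extraction_comp phi psi : extraction phi -> extraction psi ->
  extraction (fun i => phi (psi i)).
Proof. intros H K i; apply extraction_lt; auto. Qed.

Lemma extraction_frequent (P : nat -> Prop) :
  (forall N, exists i, (N <= i)%nat /\ P i) ->
  exists phi, extraction phi /\ forall i, P (phi i).
Proof.
  intros H. destruct (functional_choice _ H) as [f Hf].
  exists (fix phi i := match i with O => f O | S j => f (S (phi j)) end); split.
  - intros i. destruct (Hf (S ((fix phi i := match i with O => f O | S j => f (S (phi j)) end) i))); simpl; lia.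
  - intros [|i]; apply Hf.
Qed.

Lemma extraction_or (P Q : nat -> Prop) : (forall i, P i \/ Q i) ->
  exists phi, extraction phi /\ ((forall i, P (phi i)) \/ (forall i, Q (phi i))).
Proof.
  intros H. destruct (classic (forall N, exists i, (N <= i)%nat /\ P i)) as [C|C].
  - destruct (extraction_frequent P C) as (phi & ? & ?); exists phi; auto.
  - apply not_all_ex_not in C; destruct C as [N HN].
    exists (fun i => (N + i)%nat); split; [intros i; lia|]. right; intros i.
    destruct (H (N + i)%nat) as [Hp|]; auto.
    exfalso; apply HN; exists (N + i)%nat; split; auto; lia.
Qed.

Lemma extraction_Zconst (P : nat -> Z -> Prop) lo hi :
  (forall i, exists m, (lo <= m <= hi)%Z /\ P i m) ->
  exists phi m, extraction phi /\ (lo <= m <= hi)%Z /\ forall i, P (phi i) m.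
Proof.
  assert (G : forall n P, (forall i, exists m, (lo <= m < lo + Z.of_nat n)%Z /\ P i m) ->
    exists phi m, extraction phi /\ (lo <= m < lo + Z.of_nat n)%Z /\ forall i : nat, P (phi i) m).
  { clear; induction n as [|n IH]; intros P H.
    - destruct (H O) as (m & ? & _); lia.
    - destruct (extraction_or (fun i => P i (lo + Z.of_nat n)%Z)
        (fun i => exists m, (lo <= m < lo + Z.of_nat n)%Z /\ P i m)) as (phi & Hphi & [K|K]).
      + intros i; destruct (H i) as (m & Hm & HP).
        destruct (Z.eq_dec m (lo + Z.of_nat n)) as [->|]; auto.
        right; exists m; split; auto; lia.
      + exists phi, (lo + Z.of_nat n)%Z; repeat split; auto; lia.
      + destruct (IH (fun i m => P (phi i) m) K) as (psi & m & ? & ? & ?).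
        exists (fun i => phi (psi i)), m; repeat split; auto using extraction_comp; lia. }
  intros H. destruct (Z_le_gt_dec lo hi) as [Hle|Hgt].
  - destruct (G (Z.to_nat (hi - lo + 1)) P) as (phi & m & ? & ? & ?).
    + intros i; destruct (H i) as (m & ? & ?); exists m; split; auto; lia.
    + exists phi, m; repeat split; auto; lia.
  - destruct (H O) as (m & ? & _); lia.
Qed.

Lemma extraction_Zunbounded (f : nat -> Z) M :
  (forall B, ~ exists phi, extraction phi /\ forall i, (f (phi i) <= B)%Z) ->
  exists phi, extraction phi /\ (M <= f (phi O))%Z /\ forall i, (f (phi i) < f (phi (S i)))%Z.
Proof.
  intros H.
  assert (H1 : forall B, exists N, forall i, (N <= i)%nat -> (B < f i)%Z).
  { intros B. apply NNPP; intros C; apply (H B), (extraction_frequent (fun i => (f i <= B)%Z)).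
    intros N; apply NNPP; intros C'; apply C; exists N; intros i Hi.
    destruct (Z_lt_ge_dec B (f i)); auto. exfalso; apply C'; exists i; split; auto; lia. }
  assert (H2 : forall i, exists j, (i < j)%nat /\ (f i < f j)%Z).
  { intros i; destruct (H1 (f i)) as [N HN]; exists (S i + N)%nat; split; [lia|apply HN; lia]. }
  destruct (functional_choice _ H2) as [g Hg].
  destruct (H1 M) as [N HN].
  exists (fun i => Nat.iter i g N); repeat split.
  - intros i; simpl; apply Hg.
  - simpl; specialize (HN N (Nat.le_refl _)); lia.
  - intros i; simpl; apply Hg.
Qed.

Lemma Un_cv_extract u l phi : extraction phi -> Un_cv u l -> Un_cv (fun i => u (phi i)) l.
Proof.
  intros H Hu eps He; destruct (Hu eps He) as [N HN]; exists N; intros n Hn.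
  apply HN; pose proof (extraction_ge _ H n); lia.
Qed.

Lemma Un_cv_const l : Un_cv (fun _ => l) l.
Proof.
  intros eps He; exists O; intros n _; unfold Rdist.
  rewrite Rminus_diag, Rabs_R0; auto.
Qed.

Lemma Un_cv_p3 (p : nat -> Z) : (forall i, (p i < p (S i))%Z) -> Un_cv (fun i => p3 (- p i)) 0.
Proof.
  intros H eps He. destruct (p3_small eps He) as [K HK].
  assert (G : forall i, (p O + Z.of_nat i <= p i)%Z).
  { induction i; [lia|]; specialize (H i); lia. }
  exists (K + Z.to_nat (- p O))%nat; intros n Hn; unfold Rdist.
  rewrite Rminus_0_r, Rabs_right by (apply Rle_ge; left; apply p3_pos).
  eapply Rle_lt_trans; [|apply HK]. apply p3_le; specialize (G n); lia.
Qed.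

(* [l] splits without loss, and [x] adds a single digit 1 to the factor [a]. *)
Definition spike (c : Z) (l x : R) : Prop :=
  exists (a b : R) (ca cb r : Z),
    l = a * b /\ stle ca a /\ stle cb b /\ (ca + cb = c - 1)%Z /\ x = b * (a + p3 (- r)).

(** The shape of the terms matters only for a limit of cost exactly c - 1. The escape clause
    [stle (c - 2) l] lets products and sums of such sequences be handled without following the shape
    when the limit has cost to spare. *)
Definition tame (c : Z) (y : nat -> R) : Prop :=
  (forall i, y i = y O) \/
  exists l, (forall i, y (S i) < y i) /\ Un_cv y l /\ stle (c - 1) l /\
    (stle (c - 2) l \/ forall i, spike c l (y i)).

Lemma tame_ext c y z : (forall i, z i = y i) -> tame c y -> tame c z.
Proof.
  intros E [H|(l & Hd & Hcv & Hl & Hs)].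
  - left; intros i; rewrite !E; auto.
  - right; exists l; repeat split; auto.
    + intros i; rewrite !E; auto.
    + intros eps He; destruct (Hcv eps He) as [N HN]; exists N; intros n Hn; rewrite E; auto.
    + destruct Hs as [|Hs]; [left|right; intros i; rewrite E]; auto.
Qed.

Lemma decr_lt (y : nat -> R) : (forall i, y (S i) < y i) ->
  forall i j, (i < j)%nat -> y j < y i.
Proof.
  intros H i j Hij; induction Hij as [|j Hij IH]; auto. specialize (H j); lra.
Qed.

Lemma tame_extract c y phi : extraction phi -> tame c y -> tame c (fun i => y (phi i)).
Proof.
  intros Hphi [H|(l & Hd & Hcv & Hl & Hs)].
  - left; intros i; rewrite H, (H (phi O)); auto.
  - right; exists l; repeat split; auto using Un_cv_extract.
    + intros i; apply decr_lt; auto.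
    + destruct Hs; auto.
Qed.

Lemma tame_weaken c y : tame (c - 1) y -> tame c y.
Proof.
  intros [H|(l & Hd & Hcv & Hl & Hs)]; [left; auto|].
  right; exists l; repeat split; auto.
  - eapply stle_weaken; [|apply Hl]; lia.
  - left; eapply stle_weaken; [|apply Hl]; lia.
Qed.

Lemma spike_scale c d l x z : stle d z -> spike c l x -> spike (c + d) (l * z) (x * z).
Proof.
  intros Hz (a & b & ca & cb & r & -> & Ha & Hb & Hc & ->).
  exists a, (b * z), ca, (cb + d)%Z, r; repeat split; auto using stle_mul; try ring; lia.
Qed.

Lemma tame_mul_const c d y z : stle d z -> tame c y -> tame (c + d) (fun i => y i * z).
Proof.
  intros Hz [H|(l & Hd & Hcv & Hl & Hs)].
  - left; intros i; rewrite H; auto.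
  - pose proof (stle_pos _ _ Hz). right; exists (l * z); repeat split.
    + intros i; apply Rmult_lt_compat_r; auto.
    + apply (CV_mult y (fun _ => z)); auto using Un_cv_const.
    + replace (c + d - 1)%Z with (c - 1 + d)%Z by lia; apply stle_mul; auto.
    + destruct Hs as [Hs|Hs].
      * left; replace (c + d - 2)%Z with (c - 2 + d)%Z by lia; apply stle_mul; auto.
      * right; intros i; apply spike_scale; auto.
Qed.

(** If one factor is constant, it joins the cofactor b of the spike. If both decrease strictly, each
    limit saves one unit, so the product of the limits saves two and no shape has to be
    exhibited. *)
Lemma tame_mul c d y z : (forall i, stle c (y i)) -> (forall i, stle d (z i)) ->
  tame c y -> tame d z -> tame (c + d) (fun i => y i * z i).
Proof.
  intros Hy Hz Ty Tz.
  destruct Ty as [Ey|(l & Hd & Hcv & Hl & Hs)].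
  - apply tame_ext with (fun i => z i * y O); [intros i; rewrite Ey; ring|].
    rewrite Z.add_comm; apply tame_mul_const; auto.
  - destruct Tz as [Ez|(m & Hd' & Hcv' & Hm & _)].
    + apply tame_ext with (fun i => y i * z O); [intros i; rewrite Ez; ring|].
      apply tame_mul_const; auto. right; exists l; auto.
    + assert (Hlm : stle (c + d - 2) (l * m))
        by (replace (c + d - 2)%Z with (c - 1 + (d - 1))%Z by lia; apply stle_mul; auto).
      right; exists (l * m); repeat split; auto using CV_mult.
      * intros i; specialize (Hd i); specialize (Hd' i).
        pose proof (stle_pos _ _ (Hy (S i))); pose proof (stle_pos _ _ (Hz (S i))); nra.
      * eapply stle_weaken; [|apply Hlm]; lia.
Qed.

Lemma spike_add_p3 c a p : stle (c - 1) a -> spike c a (a + p3 (- p)).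
Proof.
  intros H; exists a, 1, (c - 1)%Z, 0%Z, p; repeat split; auto using stle_1; try ring; lia.
Qed.

(** A constant w is the limit itself, of cost c - d; this is c - 1 only for d = 1, where B = 1 and
    the terms are spikes with cofactor 1. A strictly decreasing w has a limit of cost at most c - d
    - 1, hence at most c - 2. *)
Lemma tame_add c d (w : nat -> R) (p : nat -> Z) (B : nat) :
  (1 <= d)%Z -> (1 <= B)%nat -> (d = 1%Z -> B = 1%nat) ->
  (forall i, (p i < p (S i))%Z) -> (forall i, stle (c - d) (w i)) ->
  tame (c - d) w -> tame c (fun i => w i + INR B * p3 (- p i)).
Proof.
  intros Hd HB HdB Hp Hw Tw.
  assert (HB' : 1 <= INR B) by (apply (le_INR 1); auto).
  assert (Hdec : forall i, INR B * p3 (- p (S i)) < INR B * p3 (- p i)).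
  { intros i; apply Rmult_lt_compat_l; [lra|]; apply p3_lt; specialize (Hp i); lia. }
  assert (Hcv0 : Un_cv (fun i => INR B * p3 (- p i)) 0).
  { rewrite <- (Rmult_0_r (INR B)). apply (CV_mult (fun _ => INR B) (fun i => p3 (- p i))); auto using Un_cv_const, Un_cv_p3. }
  destruct Tw as [Ew|(l & Hdw & Hcv & Hl & _)]; right.
  - exists (w O); repeat split.
    + intros i; rewrite (Ew (S i)), (Ew i); specialize (Hdec i); lra.
    + intros eps He; destruct (Hcv0 eps He) as [N HN]; exists N; intros n Hn.
      specialize (HN n Hn); unfold Rdist in *; rewrite (Ew n).
      replace (w O + INR B * p3 (- p n) - w O) with (INR B * p3 (- p n) - 0) by ring; auto.
    + eapply stle_weaken; [|apply Hw]; lia.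
    + destruct (Z.eq_dec d 1) as [->|Hd1].
      * right; intros i; rewrite (Ew i), HdB by auto; change (INR 1) with 1; rewrite Rmult_1_l; apply spike_add_p3; auto.
      * left; eapply stle_weaken; [|apply Hw]; lia.
  - exists l; repeat split.
    + intros i; specialize (Hdw i); specialize (Hdec i); lra.
    + replace l with (l + 0) by ring; apply (CV_plus w (fun i => INR B * p3 (- p i))); auto.
    + eapply stle_weaken; [|apply Hl]; lia.
    + left; eapply stle_weaken; [|apply Hl]; lia.
Qed.

(** * Splitting optimal expressions *)

(* [9 / 8]: a positive integer which is not a power of 3 loses at least this
   factor against the bound [n ^ 3 <= 3 ^ ||n||]. *)
Definition lossy (c : Z) (y : R) : Prop := stle c y /\ 9 / 8 * y ^ 3 <= p3 c.

Lemma lossy_shift j c y : lossy c y -> lossy (c + 3 * j) (y * p3 j).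
Proof.
  intros [H K]; split; [apply stle_shift; auto|].
  rewrite Rpow_mult_distr, p3_add, p3_triple.
  pose proof (pow_lt _ 3 (p3_pos j)); nra.
Qed.

Definition sum_form (c : Z) (x : R) : Prop :=
  exists (a b : iexpr) (p : Z), (ieval b <= ieval a)%nat /\
    x = (INR (ieval a) + INR (ieval b)) * p3 (- p) /\
    (Z.of_nat (iones a) + Z.of_nat (iones b) <= 3 * p + c)%Z.

(** The cost of the first factor is reduced modulo 3 by moving a power of 3 to the other factor, so
    that it takes finitely many values along a sequence. *)
Definition product_form (c : Z) (x : R) : Prop :=
  exists (y z : R) (d : Z), (0 <= d <= 2)%Z /\ x = y * z /\ lossy d y /\ lossy (c - d) z.

Lemma product_form_intro c d e y z :
  lossy d y -> lossy e z -> (d + e = c)%Z -> product_form c (y * z).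
Proof.
  intros Hy Hz <-.
  pose proof (Z.mod_pos_bound d 3); pose proof (Z.div_mod d 3).
  exists (y * p3 (- (d / 3))), (z * p3 (d / 3)), (d mod 3)%Z; repeat split; try lia.
  - transitivity (y * z * (p3 (- (d / 3)) * p3 (d / 3))); [rewrite p3_opp|]; ring.
  - replace (d mod 3)%Z with (d + 3 * - (d / 3))%Z by lia. apply lossy_shift; auto.
  - replace (d mod 3)%Z with (d + 3 * - (d / 3))%Z by lia. apply lossy_shift; auto.
  - replace (d + e - d mod 3)%Z with (e + 3 * (d / 3))%Z by lia. apply lossy_shift; auto.
  - replace (d + e - d mod 3)%Z with (e + 3 * (d / 3))%Z by lia. apply lossy_shift; auto.
Qed.

Definition split_form (c : Z) (x : R) : Prop :=
  (exists m, x = p3 m) \/ product_form c x \/ sum_form c x.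

Lemma split_form_shift j c x : split_form c x -> split_form (c + 3 * j) (x * p3 j).
Proof.
  intros [[m ->]|[(y & z & d & Hd & -> & Hy & Hz)|(a & b & p & Hab & -> & Hc)]].
  - left; exists (m + j)%Z; rewrite p3_add; auto.
  - right; left; exists y, (z * p3 j), d; split; auto; split; [ring|]; split; auto.
    replace (c + 3 * j - d)%Z with (c - d + 3 * j)%Z by lia; apply lossy_shift; auto.
  - right; right; exists a, b, (p - j)%Z; repeat split; auto; try lia.
    replace (- (p - j))%Z with (- p + j)%Z by lia; rewrite p3_add; ring.
Qed.

(** A factor equal to a power of 3 may have no defect, so splitting it off would bring no progress.
    It is moved into the scale instead, and the structural induction continues with the other factor
    until a sum, a power of 3 or a product of two lossy factors remains. *)
Lemma expr_split_form : forall e k c,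
  Z.of_nat (iones e) = (3 * k + c)%Z -> st_eq c (INR (ieval e) * p3 (- k)) ->
  split_form c (INR (ieval e) * p3 (- k)).
Proof.
  assert (Hfac : forall e f k c, (forall k c,
      Z.of_nat (iones e) = (3 * k + c)%Z -> st_eq c (INR (ieval e) * p3 (- k)) ->
      split_form c (INR (ieval e) * p3 (- k))) ->
    Z.of_nat (iones e + iones f) = (3 * k + c)%Z ->
    st_eq c (INR (ieval e * ieval f) * p3 (- k)) ->
    (exists j, ieval f = 3 ^ j)%nat -> split_form c (INR (ieval e * ieval f) * p3 (- k))).
  { intros e f k c IH Hc H [j Hj].
    assert (E : INR (ieval e * ieval f) * p3 (- k) = INR (ieval e) * p3 (- k) * p3 (Z.of_nat j))
      by (rewrite mult_INR, Hj, INR_pow3; ring).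
    rewrite E in *.
    assert (Hst : st_eq (c - 3 * Z.of_nat j) (INR (ieval e) * p3 (- k))).
    { apply (st_eq_shift (- Z.of_nat j)) in H.
      rewrite Rmult_assoc, (Rmult_comm (p3 (Z.of_nat j))), p3_opp, Rmult_1_r in H.
      replace (c - 3 * Z.of_nat j)%Z with (c + 3 * - Z.of_nat j)%Z by lia; auto. }
    assert (Hones : Z.of_nat (iones e) = (3 * k + (c - 3 * Z.of_nat j))%Z).
    (* [f] costs at least 3 j by the cubic bound and [e] at least 3 k + c - 3 j by minimality. The
       two lower bounds add up to the total cost, so both are equalities and [e] is again
       optimal. *)
    { assert (3 * Z.of_nat j <= Z.of_nat (iones f))%Z.
      { apply p3_le_inv; rewrite p3_triple, <- INR_pow3, <- Hj; apply ieval_cube_le. }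
      assert (c - 3 * Z.of_nat j <= Z.of_nat (iones e) - 3 * k)%Z; [|lia].
      apply (st_eq_le _ _ _ Hst). exists e, k; split; auto; lia. }
    specialize (IH _ _ Hones Hst); apply (split_form_shift (Z.of_nat j)) in IH.
    replace (c - 3 * Z.of_nat j + 3 * Z.of_nat j)%Z with c in IH by lia; auto. }
  induction e as [|a IHa b IHb|a IHa b IHb]; intros k c Hc H; cbn [ieval iones] in *.
  - left; exists (- k)%Z; simpl; ring.
  - right; right. destruct (Nat.le_ge_cases (ieval b) (ieval a)).
    + exists a, b, k; rewrite plus_INR; repeat split; auto; lia.
    + exists b, a, k; rewrite plus_INR, Rplus_comm; repeat split; auto; lia.
  - destruct (ieval_cube_le_sharp b) as [Hb|Hb]; [apply Hfac; auto|].
    destruct (ieval_cube_le_sharp a) as [Ha|Ha].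
    { rewrite Nat.mul_comm in *; rewrite Nat.add_comm in Hc; apply Hfac; auto. }
    right; left. rewrite mult_INR, Rmult_assoc.
    assert (Hl : lossy (Z.of_nat (iones a)) (INR (ieval a))).
    { split; auto. exists a, 0%Z; rewrite Z.opp_0, p3_0, Rmult_1_r; split; auto; lia. }
    assert (Hr : lossy (Z.of_nat (iones b) + 3 * - k) (INR (ieval b) * p3 (- k))).
    { apply lossy_shift; split; auto.
      exists b, 0%Z; rewrite Z.opp_0, p3_0, Rmult_1_r; split; auto; lia. }
    apply (product_form_intro _ _ _ _ _ Hl Hr); lia.
Qed.

Lemma st_eq_split_form c x : st_eq c x -> split_form c x.
Proof.
  intros H; pose proof H as [(e & k & -> & Hc) _].
  apply expr_split_form; auto. apply Z.le_antisymm; auto.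
  assert (c <= Z.of_nat (iones e) - 3 * k)%Z; [|lia].
  apply (st_eq_le _ _ _ H); exists e, k; split; auto; lia.
Qed.

(** * Compactness by induction on the defect *)

Lemma INR_le_archimed (M : R) : exists hi : Z, forall n : nat, INR n <= M -> (Z.of_nat n <= hi)%Z.
Proof.
  exists (up M); intros n Hn. apply le_IZR. rewrite <- INR_IZR_INZ.
  destruct (archimed M); lra.
Qed.

Lemma le_cube x : 1 <= x -> x <= x ^ 3.
Proof. intros H; simpl; nra. Qed.

Lemma div_le_intro a b c : 0 < c -> a <= b * c -> a / c <= b.
Proof.
  intros Hc H; apply Rmult_le_reg_r with c; auto.
  unfold Rdiv; rewrite Rmult_assoc, Rinv_l; lra.
Qed.

Lemma lt_div_elim a b c : 0 < c -> a < b / c -> a * c < b.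
Proof.
  intros Hc H; apply (Rmult_lt_compat_r c) in H; auto.
  unfold Rdiv in H; rewrite Rmult_assoc, Rinv_l in H; lra.
Qed.

Definition tame_below (h : R) (c : Z) : Prop :=
  forall x : nat -> R, (forall i, stle c (x i) /\ h <= x i ^ 3) ->
  exists phi, extraction phi /\ tame c (fun i => x (phi i)).

(** The loss of each factor is credited to the other: 9 / 8 * z ^ 3 <= 3 ^ (c - d) and h <= y ^ 3 *
    z ^ 3 raise the lower bound of y ^ 3 by 9 / 8, so the ratio of [p3 d] to that bound is that of
    [p3 c] to h divided by 9 / 8. The hypothesis on d and h' expresses exactly this gain. *)
Lemma tame_below_product h c :
  0 < h -> (forall d h', 0 < h' -> p3 d * h * (9 / 8) <= p3 c * h' -> tame_below h' d) ->
  forall x : nat -> R, (forall i, product_form c (x i) /\ h <= x i ^ 3) ->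
  exists phi, extraction phi /\ tame c (fun i => x (phi i)).
Proof.
  intros Hh IH x Hx.
  destruct (extraction_Zconst (fun i d => exists y z, x i = y * z /\ lossy d y /\ lossy (c - d) z) 0 2)
    as (phi & d & Hphi & _ & H).
  { intros i; destruct (Hx i) as [(y & z & d & Hd & Hyz) _]; exists d; split; eauto. }
  apply functional_choice in H; destruct H as [y H].
  apply functional_choice in H; destruct H as [z H].
  assert (Hy : forall i, lossy d (y i)) by apply H.
  assert (Hz : forall i, lossy (c - d) (z i)) by apply H.
  assert (Hc : p3 c = p3 d * p3 (c - d)) by (rewrite <- p3_add; f_equal; lia).
  assert (Hlow : forall d u v i, (p3 c = p3 d * p3 (c - d)) -> lossy (c - d) v -> lossy d u -> x (phi i) = u * v ->
    h * (9 / 8) / p3 (c - d) <= u ^ 3).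
  { intros d' u v i E [_ Hv] [Hu _] Exy. apply div_le_intro; [apply p3_pos|].
    destruct (Hx (phi i)) as [_ Hi]. rewrite Exy, Rpow_mult_distr in Hi.
    pose proof (pow_lt _ 3 (stle_pos _ _ Hu)). nra. }
  assert (Hy3 : forall i, h * (9 / 8) / p3 (c - d) <= y i ^ 3).
  { intros i; apply (Hlow d _ (z i) i); auto; apply H. }
  assert (Hz3 : forall i, h * (9 / 8) / p3 d <= z i ^ 3).
  { intros i; replace d with (c - (c - d))%Z by lia.
    apply (Hlow (c - d)%Z _ (y i) i); auto.
    - replace (c - (c - d))%Z with d by lia; lra.
    - replace (c - (c - d))%Z with d by lia; auto.
    - destruct (H i) as [-> _]; ring. }
  destruct (IH d (h * (9 / 8) / p3 (c - d))) with (x := y) as (psi & Hpsi & Ty).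
  { apply Rdiv_lt_0_compat; [lra | apply p3_pos]. }
  { rewrite Hc; right; field. pose proof (p3_pos (c - d)); lra. }
  { intros i; split; auto; apply Hy. }
  destruct (IH (c - d)%Z (h * (9 / 8) / p3 d)) with (x := fun i => z (psi i)) as (chi & Hchi & Tz).
  { apply Rdiv_lt_0_compat; [lra | apply p3_pos]. }
  { rewrite Hc; right; field. pose proof (p3_pos d); lra. }
  { intros i; split; auto; apply Hz. }
  exists (fun i => phi (psi (chi i))); split.
  { exact (extraction_comp _ _ Hphi (extraction_comp _ _ Hpsi Hchi)). }
  apply tame_ext with (fun i => y (psi (chi i)) * z (psi (chi i))); [intros i; apply H|].
  replace c with (d + (c - d))%Z by lia. apply tame_mul; auto.
  - intros i; apply Hy.
  - intros i; apply Hz.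
  - apply (tame_extract _ (fun i => y (psi i))); auto.
Qed.

(** The cost of 3 ^ m is exactly 3 m, by [stle_p3] and the cubic bound, so c determines m. *)
Lemma tame_below_power c :
  forall x : nat -> R, (forall i, st_eq c (x i) /\ exists m, x i = p3 m) ->
  exists phi, extraction phi /\ tame c (fun i => x (phi i)).
Proof.
  intros x Hx. exists (fun i => i); split; [intros i; lia|].
  assert (E : forall i, exists m, x i = p3 m /\ c = (3 * m)%Z).
  { intros i; destruct (Hx i) as [H [m Hm]]; exists m; split; auto.
    rewrite Hm in H; apply Z.le_antisymm.
    - apply (st_eq_le _ _ _ H), stle_p3.
    - destruct H as [H _]; apply stle_cube in H. rewrite <- p3_triple in H. apply p3_le_inv; auto. }
  left; intros i. destruct (E i) as (m & -> & Hm), (E O) as (m' & -> & Hm').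
  f_equal; lia.
Qed.

Lemma tame_below_sum h c :
  0 < h -> (forall d, (d < c)%Z -> tame_below (3 / 8 * h) d) ->
  forall x : nat -> R, (forall i, stle c (x i) /\ sum_form c (x i) /\ h <= x i ^ 3) ->
  exists phi, extraction phi /\ tame c (fun i => x (phi i)).
Proof.
  intros Hh IH x Hx.
  assert (Hform : forall i, exists q : iexpr * iexpr * Z, let '(a, b, p) := q in
    (ieval b <= ieval a)%nat /\ x i = (INR (ieval a) + INR (ieval b)) * p3 (- p) /\
    (Z.of_nat (iones a) + Z.of_nat (iones b) <= 3 * p + c)%Z).
  { intros i; destruct (Hx i) as (_ & (a & b & p & H) & _); exists (a, b, p); auto. }
  apply functional_choice in Hform; destruct Hform as [q Hq].
  set (a i := fst (fst (q i))); set (b i := snd (fst (q i))); set (p i := snd (q i)).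
  assert (Hab : forall i, (ieval (b i) <= ieval (a i))%nat /\
    x i = (INR (ieval (a i)) + INR (ieval (b i))) * p3 (- p i) /\
    (Z.of_nat (iones (a i)) + Z.of_nat (iones (b i)) <= 3 * p i + c)%Z).
  { intros i; specialize (Hq i); unfold a, b, p; destruct (q i) as [[? ?] ?]; auto. }
  clearbody a b p; clear q Hq.
  assert (Hones : exists M, forall i, (Z.of_nat (iones (b i)) <= M)%Z).
  { destruct (p3_small h Hh) as [K HK].
    exists (c + Z.of_nat K + 3)%Z; intros i.
    destruct (Hab i) as (Hle & Ex & Hc), (Hx i) as (_ & _ & Hi).
    assert (Hs : stle (c - Z.of_nat (iones (b i))) (INR (ieval (a i)) * p3 (- p i)))
      by (exists (a i), (p i); split; [auto|lia]).
    apply stle_cube in Hs.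
    apply le_INR in Hle. pose proof (p3_pos (- p i)). pose proof (ieval_INR_pos (b i)).
    assert (H2 : x i ^ 3 <= (2 * (INR (ieval (a i)) * p3 (- p i))) ^ 3).
    { rewrite Ex; apply cube_le; [nra|]. nra. }
    rewrite Rpow_mult_distr in H2.
    (* The factor 8 = 2 ^ 3 coming from x <= 2 A / 3 ^ p is rounded up to 9 = 3 ^ 2. *)
    assert (H3 : p3 (- Z.of_nat K) < p3 (c - Z.of_nat (iones (b i)) + 2)).
    { rewrite p3_add; replace (p3 2) with 9 by (unfold p3; simpl; ring).
      pose proof (p3_pos (c - Z.of_nat (iones (b i)))). lra. }
    apply p3_lt_inv in H3; lia. }
  destruct Hones as [M HM].
  destruct (extraction_Zconst (fun i d => Z.of_nat (iones (b i)) = d) 1 M) as (phi & d & Hphi & Hd & Ed).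
  { intros i; eexists; split; eauto. specialize (HM i); pose proof (iones_pos (b i)); lia. }
  destruct (INR_le_archimed (p3 d)) as [hi Hhi].
  destruct (extraction_Zconst (fun i B => Z.of_nat (ieval (b (phi i))) = B) 1 hi) as (psi & B & Hpsi & HB & EB).
  { intros i; eexists; split; eauto. pose proof (ieval_pos (b (phi i))); split; [lia|].
    apply Hhi. eapply Rle_trans; [apply le_cube, ieval_INR_pos|].
    rewrite <- (Ed i); apply ieval_cube_le. }
  set (f i := phi (psi i)).
  assert (Hf : extraction f) by exact (extraction_comp _ _ Hphi Hpsi).
  assert (EBf : forall i, ieval (b (f i)) = Z.to_nat B) by (intros i; specialize (EB i); unfold f; lia).
  assert (Edf : forall i, Z.of_nat (iones (b (f i))) = d) by (intros i; apply Ed).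
  (* If p is bounded along a subsequence, then A, B and p take finitely many values and a further
     subsequence is constant. Otherwise p can be made strictly increasing, and B / 3 ^ p is a
     vanishing perturbation of A / 3 ^ p. *)
  destruct (classic (exists P g, extraction g /\ forall i, (p (f (g i)) <= P)%Z)) as [(P & g & Hg & HP)|Hunb].
  - destruct (INR_le_archimed (p3 (3 * P + c))) as [hi' Hhi'].
    destruct (extraction_Zconst (fun i p' => p (f (g i)) = p') (- Z.abs c) P) as (k & p' & Hk & Hp' & Ep).
    { intros i; eexists; split; eauto; split; auto.
      destruct (Hab (f (g i))) as (_ & Ex & _), (Hx (f (g i))) as (Hs & _ & _).
      apply stle_cube in Hs. rewrite Ex, Rpow_mult_distr, <- p3_triple in Hs.
      pose proof (ieval_INR_pos (b (f (g i)))). pose proof (ieval_INR_pos (a (f (g i)))).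
      pose proof (p3_pos (3 * - p (f (g i)))).
      assert (1 <= (INR (ieval (a (f (g i)))) + INR (ieval (b (f (g i))))) ^ 3)
        by (apply pow_R1_Rle; lra).
      assert (Hle : p3 (3 * - p (f (g i))) <= p3 c) by nra.
      apply p3_le_inv in Hle; lia. }
    destruct (extraction_Zconst (fun i A => Z.of_nat (ieval (a (f (g (k i))))) = A) 0 hi')
      as (k' & A & Hk' & _ & EA).
    { intros i; eexists; split; eauto; split; [lia|]. apply Hhi'.
      eapply Rle_trans; [apply le_cube, ieval_INR_pos|].
      eapply Rle_trans; [apply ieval_cube_le|apply p3_le].
      destruct (Hab (f (g (k i)))) as (_ & _ & ?). specialize (HP (k i)). lia. }
    exists (fun i => f (g (k (k' i)))); split.
    { exact (extraction_comp _ _ Hf (extraction_comp _ _ Hg (extraction_comp _ _ Hk Hk'))). }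
    left. assert (E : forall i, x (f (g (k (k' i)))) = (INR (Z.to_nat A) + INR (Z.to_nat B)) * p3 (- p')).
    { intros i; destruct (Hab (f (g (k (k' i))))) as (_ & -> & _).
      rewrite EBf, Ep. replace (ieval (a (f (g (k (k' i)))))) with (Z.to_nat A); auto.
      rewrite <- (EA i); lia. }
    intros i; rewrite E, (E O); auto.
  (* This threshold makes B / 3 ^ p at most x / 4. Then w >= 3 / 4 * x, and (3 / 4) ^ 3 = 27 / 64 is
     more than the 3 / 8 that the hypothesis tolerates. *)
  - destruct (p3_small (h / (4 * INR (Z.to_nat B)) ^ 3)) as [K HK].
    { assert (1 <= INR (Z.to_nat B)) by (apply (le_INR 1); lia).
      apply Rdiv_lt_0_compat; auto; apply pow_lt; lra. }
    destruct (extraction_Zunbounded (fun i => p (f i)) (Z.of_nat K)) as (g & Hg & Hg0 & Hpg).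
    { intros P [g Hg]; apply Hunb; exists P, g; auto. }
    assert (HKp : forall i, (Z.of_nat K <= p (f (g i)))%Z).
    { induction i; auto; specialize (Hpg i); lia. }
    set (w i := INR (ieval (a (f (g i)))) * p3 (- p (f (g i)))).
    assert (Ex : forall i, x (f (g i)) = w i + INR (Z.to_nat B) * p3 (- p (f (g i)))).
    { intros i; destruct (Hab (f (g i))) as (_ & -> & _). rewrite EBf; unfold w; ring. }
    assert (Hw : forall i, stle (c - d) (w i)).
    { intros i; exists (a (f (g i))), (p (f (g i))); split; auto.
      destruct (Hab (f (g i))) as (_ & _ & ?). specialize (Edf (g i)); lia. }
    destruct (IH (c - d)%Z) with (x := w) as (k & Hk & Tw); [lia| |].
    { intros i; split; auto.
      destruct (Hx (f (g i))) as (Hs & _ & Hi). apply stle_pos in Hs.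
      assert (HB1 : 1 <= INR (Z.to_nat B)) by (apply (le_INR 1); lia).
      assert (Hsmall : 4 * INR (Z.to_nat B) * p3 (- p (f (g i))) <= x (f (g i))).
      { apply cube_le_inv; [lra|]. eapply Rle_trans; [|apply Hi].
        rewrite Rpow_mult_distr, <- p3_triple.
        assert (Hp3 : p3 (3 * - p (f (g i))) <= p3 (- Z.of_nat K)) by (apply p3_le; specialize (HKp i); lia).
        assert (0 < (4 * INR (Z.to_nat B)) ^ 3) by (apply pow_lt; lra).
        apply lt_div_elim in HK; [|lra].
        rewrite Rmult_comm in HK. eapply Rle_trans; [apply Rmult_le_compat_l|]; [lra|apply Hp3|lra]. }
      assert (Hlow : (3 / 4 * x (f (g i))) ^ 3 <= w i ^ 3).
      { apply cube_le; [lra|]. specialize (Ex i); lra. }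
      rewrite Rpow_mult_distr in Hlow. lra. }
    exists (fun i => f (g (k i))); split.
    { exact (extraction_comp _ _ Hf (extraction_comp _ _ Hg Hk)). }
    apply tame_ext with (fun i => w (k i) + INR (Z.to_nat B) * p3 (- p (f (g (k i))))); [intros i; apply Ex|].
    apply (tame_add c d (fun i => w (k i)) (fun i => p (f (g (k i))))); auto; try lia.
    + intros ->. assert (Hb := ieval_bound (b (f (g O)))).
      specialize (Edf (g O)); rewrite EBf in Hb. destruct Hb as [Hb _].
      replace (iones (b (f (g O)))) with 1%nat in Hb by lia. simpl in Hb.
      assert (1 <= Z.to_nat B)%nat by lia. nia.
    + intros i; assert (G : forall i j, (i < j)%nat -> (p (f (g i)) < p (f (g j)))%Z).
      { clear -Hpg; intros i j Hij; induction Hij as [|j Hij IH]; auto; specialize (Hpg j); lia. }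
      apply G, Hk.
Qed.

(* Induction on the defect, in units of the smallest loss [9 / 8]. *)
Lemma tame_below_defect N : forall c h, 0 < h -> p3 c < h * (9 / 8) ^ N -> tame_below h c.
Proof.
  induction N as [|N IH]; intros c h Hh Hc x Hx.
  - exfalso; destruct (Hx O) as [H Hi]; apply stle_cube in H; simpl in Hc; lra.
  - assert (Hq : 0 < (9 / 8) ^ N) by (apply pow_lt; lra). simpl in Hc.
    (* A drop of one unit of cost divides [p3 c] by 3, and 3 * (3 / 8) = 9 / 8: lowering h to 3 / 8
       * h still gains one quantum. *)
    assert (Hdrop : forall d, (d < c)%Z -> tame_below (3 / 8 * h) d).
    { intros d Hd; apply IH; [lra|].
      assert (p3 (d + 1) <= p3 c) by (apply p3_le; lia). rewrite p3_add, p3_1 in *. lra. }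
    destruct (extraction_or (fun i => stle (c - 1) (x i)) (fun i => st_eq c (x i))) as (phi & Hphi & [H|H]).
    { intros i; destruct (classic (stle (c - 1) (x i))); auto. right; split; auto; apply Hx. }
    + destruct (Hdrop (c - 1)%Z) with (x := fun i => x (phi i)) as (psi & Hpsi & T); [lia| |].
      { intros i; split; auto. destruct (Hx (phi i)); lra. }
      exists (fun i => phi (psi i)); split; [exact (extraction_comp _ _ Hphi Hpsi)|].
      apply tame_weaken; auto.
    + destruct (extraction_or (fun i => exists m, x (phi i) = p3 m)
        (fun i => product_form c (x (phi i)) \/ sum_form c (x (phi i)))) as (psi & Hpsi & [K|K]).
      { intros i; apply st_eq_split_form; auto. }
      * destruct (tame_below_power c (fun i => x (phi (psi i)))) as (chi & Hchi & T); auto.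
        exists (fun i => phi (psi (chi i))); split; auto.
        exact (extraction_comp _ _ Hphi (extraction_comp _ _ Hpsi Hchi)).
      * destruct (extraction_or (fun i => product_form c (x (phi (psi i))))
          (fun i => sum_form c (x (phi (psi i)))) K) as (chi & Hchi & [L|L]).
        -- destruct (tame_below_product h c Hh) with (x := fun i => x (phi (psi (chi i)))) as (k & Hk & T).
           { intros d h' Hh' Hle; apply IH; auto. pose proof (p3_pos d); pose proof (p3_pos c).
             apply Rmult_lt_reg_l with (h * (9 / 8)); [lra|].
             apply Rle_lt_trans with (p3 c * h'); [lra|].
             apply Rlt_le_trans with (h * (9 / 8 * (9 / 8) ^ N) * h'); [|right; ring].
             apply Rmult_lt_compat_r; auto. }
           { intros i; split; auto; apply Hx. }
           exists (fun i => phi (psi (chi (k i)))); split; auto.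
           exact (extraction_comp _ _ Hphi (extraction_comp _ _ Hpsi (extraction_comp _ _ Hchi Hk))).
        -- destruct (tame_below_sum h c Hh Hdrop (fun i => x (phi (psi (chi i))))) as (k & Hk & T).
           { intros i; split; [apply Hx|]; split; auto; apply Hx. }
           exists (fun i => phi (psi (chi (k i)))); split; auto.
           exact (extraction_comp _ _ Hphi (extraction_comp _ _ Hpsi (extraction_comp _ _ Hchi Hk))).
Qed.

Lemma tame_subsequence c h (x : nat -> R) : 0 < h ->
  (forall i, stle c (x i) /\ h <= x i ^ 3) ->
  exists phi, extraction phi /\ tame c (fun i => x (phi i)).
Proof.
  intros Hh. destruct (Pow_x_infinity (9 / 8)) with (b := p3 c / h + 1) as [N HN].
  { rewrite Rabs_right; lra. }
  apply (tame_below_defect N); auto.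
  specialize (HN N (Nat.le_refl N)). rewrite Rabs_right in HN by (apply Rle_ge, pow_le; lra).
  apply Rmult_lt_reg_r with (/ h); [apply Rinv_0_lt_compat; auto|].
  replace (h * (9 / 8) ^ N * / h) with ((9 / 8) ^ N) by (field; lra).
  unfold Rdiv in HN; lra.
Qed.

Lemma inv_INR_small eps : 0 < eps -> exists N : nat, forall n : nat, (N <= n)%nat -> / INR (S n) < eps.
Proof.
  intros He. destruct (cv_infty_cv_0 INR) with (eps := eps) as [N HN]; auto.
  { intros M. exists (Z.to_nat (up M)); intros n Hn.
    apply Rlt_le_trans with (IZR (up M)); [apply archimed|].
    rewrite INR_IZR_INZ; apply IZR_le; lia. }
  exists N; intros n Hn. specialize (HN (S n)); unfold Rdist in HN.
  rewrite Rminus_0_r, Rabs_right in HN; [apply HN; lia|].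
  apply Rle_ge; left; apply Rinv_0_lt_compat, lt_0_INR; lia.
Qed.

(** The constant case of [tame] is excluded because the terms differ from their limit x. The set P
    is left free: taking the points below x rules out accumulation from below, and taking the points
    that are not spikes shows that all nearby points are spikes. *)
Lemma accumulation c x (P : R -> Prop) : 0 < x ->
  (forall y, P y -> stle c y) ->
  (forall eps, 0 < eps -> exists y, P y /\ y <> x /\ Rabs (y - x) < eps) ->
  stle (c - 1) x /\ exists y, P y /\ x < y /\ (stle (c - 2) x \/ spike c x y).
Proof.
  intros Hx HP H.
  assert (Hy : forall i : nat, exists y, (P y /\ y <> x) /\ Rabs (y - x) < Rmin (x / 2) (/ INR (S i))).
  { intros i; destruct (H (Rmin (x / 2) (/ INR (S i)))) as (y & ? & ? & ?); [|exists y; auto].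
    apply Rmin_pos; [lra|]. apply Rinv_0_lt_compat, lt_0_INR; lia. }
  apply functional_choice in Hy; destruct Hy as [y Hy].
  destruct (tame_subsequence c ((x / 2) ^ 3) y) as (phi & Hphi & T).
  { apply pow_lt; lra. }
  { intros i; split; [apply HP, Hy|]. apply cube_le; [lra|].
    destruct (Hy i) as [_ Hi]. apply Rabs_def2 in Hi.
    pose proof (Rmin_l (x / 2) (/ INR (S i))); lra. }
  assert (Hcv : Un_cv y x).
  { intros eps He; destruct (inv_INR_small eps He) as [N HN]; exists N; intros n Hn.
    destruct (Hy n) as [_ Hi]. pose proof (Rmin_r (x / 2) (/ INR (S n))).
    specialize (HN n Hn); unfold Rdist; lra. }
  apply (Un_cv_extract _ _ _ Hphi) in Hcv.
  destruct T as [E|(l & Hd & Hl & Hs & Hsp)].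
  - exfalso. destruct (Hy (phi O)) as [[_ Hne] _]. apply Hne.
    apply (UL_sequence (fun i => y (phi i))); auto.
    intros eps He; exists O; intros n _. rewrite E; unfold Rdist; rewrite Rminus_diag, Rabs_R0; auto.
  - assert (l = x) as -> by (apply (UL_sequence (fun i => y (phi i))); auto).
    split; auto. exists (y (phi O)); repeat split; [apply Hy| |].
    + apply Rle_lt_trans with (y (phi 1%nat)); [|apply Hd].
      apply (decreasing_ineq (fun i => y (phi i)) x) with (n := 1%nat); auto.
      intros i; left; apply Hd.
    + destruct Hsp; auto.
Qed.

(** * The derived sets of [K0] *)

Lemma not_accumulation_below c x : 0 < x ->
  exists eps, 0 < eps /\ forall y, stle c y -> Rabs (y - x) < eps -> x <= y.
Proof.
  intros Hx; apply NNPP; intros C.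
  destruct (accumulation c x (fun y => stle c y /\ y < x)) as (_ & y & [_ Hy] & Hy' & _); auto.
  - intros y [H _]; auto.
  - intros eps He; apply NNPP; intros C'; apply C; exists eps; split; auto.
    intros y Hy Hd; apply Rnot_lt_le; intros Hlt; apply C'; exists y; repeat split; auto; lra.
  - lra.
Qed.

Lemma accumulation_stle c x : 0 < x ->
  (forall eps, 0 < eps -> exists y, stle c y /\ y <> x /\ Rabs (y - x) < eps) -> stle (c - 1) x.
Proof. intros Hx H; apply (accumulation c x (stle c)); auto. Qed.

Lemma spike_near c x : st_eq (c - 1) x ->
  exists eps, 0 < eps /\ forall y, stle c y -> y <> x -> Rabs (y - x) < eps -> spike c x y.
Proof.
  intros [H H']; apply NNPP; intros C.
  destruct (accumulation c x (fun y => stle c y /\ ~ spike c x y)) as (_ & y & [_ Hy] & _ & [K|K]); auto.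
  - eapply stle_pos; eauto.
  - intros y [? _]; auto.
  - intros eps He; apply NNPP; intros C'; apply C; exists eps; split; auto.
    intros y Hy Hne Hd; apply NNPP; intros Hs; apply C'; exists y; repeat split; auto.
  - apply H'; replace (c - 1 - 1)%Z with (c - 2)%Z by lia; auto.
Qed.

(** A supremum outside S would be approached from below, which [not_accumulation_below] forbids. All
    well-ordering arguments rest on this. *)
Lemma stle_max c (S : R -> Prop) : (forall x, S x -> stle c x) -> (exists x, S x) ->
  exists m, S m /\ forall y, S y -> y <= m.
Proof.
  intros HS [x0 Hx0].
  destruct (completeness S) as [s [Hub Hlub]].
  { exists (1 + p3 c); intros x Hx. pose proof (stle_cube _ _ (HS x Hx)). pose proof (p3_pos c).
    destruct (Rle_or_lt x 1); [lra|]. pose proof (le_cube x); lra. }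
  { exists x0; auto. }
  assert (Hs : 0 < s) by (pose proof (Hub x0 Hx0); pose proof (stle_pos _ _ (HS _ Hx0)); lra).
  destruct (not_accumulation_below c s Hs) as (eps & He & H).
  assert (HSs : S s).
  { apply NNPP; intros C.
    assert (Hs' : s <= s - eps); [|lra].
    apply Hlub; intros y Hy. pose proof (Hub y Hy) as Hys.
    apply Rnot_lt_le; intros Hlt.
    assert (s <= y) by (apply H; auto; apply Rabs_def1; lra).
    apply C; replace s with y by lra; auto. }
  exists s; split; auto.
Qed.

Lemma st_eq_next c x eps : st_eq c x -> 0 < eps ->
  exists y, st_eq (c + 1) y /\ x < y < x + eps.
Proof.
  intros [H H'] He. destruct (stle_add_p3 _ _ H) as [r0 Hr].
  apply NNPP; intros C; apply H', accumulation_stle; [eapply stle_pos; eauto|].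
  intros d Hd. destruct (p3_small (Rmin eps d)) as [K HK]; [apply Rmin_pos; auto|].
  pose proof (Rmin_l eps d); pose proof (Rmin_r eps d).
  assert (Hle : p3 (- Z.of_nat (r0 + K)) <= p3 (- Z.of_nat K)) by (apply p3_le; lia).
  pose proof (p3_pos (- Z.of_nat (r0 + K))).
  exists (x + p3 (- Z.of_nat (r0 + K))); repeat split; [|lra|apply Rabs_def1; lra].
  apply NNPP; intros C'; apply C; exists (x + p3 (- Z.of_nat (r0 + K))).
  repeat split; [apply Hr; lia| |lra|lra].
  replace (c + 1 - 1)%Z with c by lia; auto.
Qed.

Lemma accumulation_intro c x eps : stle (c - 1) x -> 0 < eps ->
  exists y, stle c y /\ x < y < x + eps.
Proof.
  intros H He; destruct (st_eq_exists _ _ H) as (d & Hd & Hst).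
  destruct (st_eq_next _ _ _ Hst He) as (y & [Hy _] & Hxy).
  exists y; split; auto. eapply stle_weaken; [|apply Hy]; lia.
Qed.

Lemma stle_small c eps : 0 < eps -> exists y, stle c y /\ y < eps.
Proof.
  intros He; destruct (p3_small eps He) as [K HK].
  exists (p3 (- Z.of_nat (K + Z.to_nat (Z.abs c)))); split.
  - eapply stle_weaken; [|apply stle_p3]. lia.
  - eapply Rle_lt_trans; [|apply HK]. apply p3_le; lia.
Qed.

Definition stle0 (c : Z) (x : R) : Prop := x = 0 \/ stle c x.

Lemma stle0_nonneg c x : stle0 c x -> 0 <= x.
Proof. intros [->|H]; [lra|]. left; eapply stle_pos; eauto. Qed.

Lemma derived_ext A B : (forall x, A x <-> B x) -> forall x, derived A x <-> derived B x.
Proof.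
  intros E x; split; intros H eps He; destruct (H eps He) as (y & Hy & ?); exists y; split; auto;
    apply E; auto.
Qed.

Lemma derived_stle0 c x : derived (stle0 c) x <-> stle0 (c - 1) x.
Proof.
  split.
  - intros H. destruct (Rtotal_order x 0) as [Hx|[Hx|Hx]].
    + exfalso; destruct (H (- x)) as (y & Hy & _ & Hd); [lra|].
      apply stle0_nonneg in Hy; apply Rabs_def2 in Hd; lra.
    + left; auto.
    + right; apply accumulation_stle; auto.
      intros eps He; destruct (H (Rmin eps x)) as (y & [->|Hy] & Hne & Hd); [apply Rmin_pos; auto| |].
      * apply Rabs_def2 in Hd; pose proof (Rmin_r eps x); lra.
      * exists y; repeat split; auto. pose proof (Rmin_l eps x); lra.
  - intros [->|H] eps He.
    + destruct (stle_small c eps He) as (y & Hy & Hlt). pose proof (stle_pos _ _ Hy).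
      exists y; repeat split; [right; auto|lra|apply Rabs_def1; lra].
    + destruct (accumulation_intro _ _ _ H He) as (y & Hy & Hxy).
      exists y; repeat split; [right; auto|lra|apply Rabs_def1; lra].
Qed.

Lemma closure_stle0 c x : closure_R (stle0 c) x -> stle0 c x.
Proof.
  intros H. destruct (classic (stle0 c x)) as [|C]; auto.
  assert (stle0 (c - 1) x) as [->|K]; [|left; auto|right].
  - apply derived_stle0. intros eps He; destruct (H eps He) as (y & Hy & Hd).
    exists y; repeat split; auto. congruence.
  - eapply stle_weaken; [|apply K]; lia.
Qed.

(** * Complexity, stable numbers and the layers of [K0] *)

Lemma cpx_spec n : (1 <= n)%nat -> is_complexity n (cpx n).
Proof.
  intros Hn; apply (epsilon_spec (inhabits 0%nat) (fun c => is_complexity n c)).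
  assert (He : exists e, ieval e = n).
  { induction Hn as [|n Hn [e He]]; [exists EOne; auto|].
    exists (EPlus e EOne); simpl; lia. }
  destruct He as [e He].
  destruct (dec_inh_nat_subset_has_unique_least_element
    (fun c => exists e, ieval e = n /\ iones e = c)) as (c & [Hc Hleast] & _).
  - intros c; apply classic.
  - exists (iones e), e; auto.
  - exists c; split; auto. intros f Hf; apply Hleast; exists f; auto.
Qed.

Lemma stle_of_cpx n k c : (1 <= n)%nat -> (Z.of_nat (cpx n) <= 3 * k + c)%Z -> stle c (INR n * p3 (- k)).
Proof.
  intros Hn Hc; destruct (cpx_spec n Hn) as [(e & He & Hones) _].
  exists e, k; rewrite He, Hones; auto.
Qed.

Lemma cpx_le_of_stle n c : (1 <= n)%nat -> stle c (INR n) ->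
  exists k0 : nat, forall k : nat, (k0 <= k)%nat -> (Z.of_nat (cpx (3 ^ k * n)) <= 3 * Z.of_nat k + c)%Z.
Proof.
  intros Hn H; destruct (stle_large _ _ H) as [k0 Hk]; exists k0; intros k Hle.
  destruct (Hk k Hle) as (e & He & Hc).
  rewrite <- INR_pow3, <- mult_INR in He; apply INR_eq in He.
  destruct (cpx_spec (3 ^ k * n)) as [_ Hmin].
  { pose proof (pow3_gt0 k); nia. }
  specialize (Hmin e); rewrite He in Hmin. specialize (Hmin (Nat.mul_comm _ _)); lia.
Qed.

Lemma cpx_ge_of_st_eq n c k : (1 <= n)%nat -> st_eq c (INR n) ->
  (3 * Z.of_nat k + c <= Z.of_nat (cpx (3 ^ k * n)))%Z.
Proof.
  intros Hn H. assert (c <= Z.of_nat (cpx (3 ^ k * n)) - 3 * Z.of_nat k)%Z; [|lia].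
  apply (st_eq_le _ _ _ H).
  replace (INR n) with (INR (3 ^ k * n) * p3 (- Z.of_nat k)).
  - apply stle_of_cpx; [pose proof (pow3_gt0 k); nia|lia].
  - rewrite mult_INR, INR_pow3. transitivity (INR n * (p3 (- Z.of_nat k) * p3 (Z.of_nat k))); [ring|].
    rewrite p3_opp; ring.
Qed.

Lemma st_eq_INR_exists n : (1 <= n)%nat -> exists c, st_eq c (INR n).
Proof.
  intros Hn. destruct (st_eq_exists (Z.of_nat (cpx n)) (INR n)) as (c & _ & H); [|exists c; auto].
  replace (INR n) with (INR n * p3 (- 0)) by (rewrite Z.opp_0, p3_0; ring).
  apply stle_of_cpx; auto; lia.
Qed.

(** The complexity of 3 ^ k * n minus 3 k does not increase with k, is never below c, and equals c
    for large k; stability says that c has already been reached. *)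
Lemma stable_pow3_mul n c a : (1 <= n)%nat -> st_eq c (INR n) ->
  (stable (3 ^ a * n) <-> Z.of_nat (cpx (3 ^ a * n)) = (3 * Z.of_nat a + c)%Z).
Proof.
  intros Hn H. destruct (cpx_le_of_stle n c Hn) as [k0 Hk]; [apply H|].
  assert (E : forall k, (3 ^ k * (3 ^ a * n) = 3 ^ (k + a) * n)%nat) by (intros k; rewrite Nat.pow_add_r; lia).
  split.
  - intros [_ Hs]. specialize (Hs k0). rewrite E in Hs.
    assert (H1 := Hk (k0 + a)%nat ltac:(lia)).
    assert (H2 := cpx_ge_of_st_eq n c a Hn H). lia.
  - intros Ha; split; [pose proof (pow3_gt0 a); nia|]. intros k; rewrite E.
    assert (H2 := cpx_ge_of_st_eq n c (k + a) Hn H).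
    destruct (cpx_spec (3 ^ a * n)) as [(e & He & Ho) _]; [pose proof (pow3_gt0 a); nia|].
    destruct (cpx_spec (3 ^ (k + a) * n)) as [_ Hmin]; [pose proof (pow3_gt0 (k + a)); nia|].
    specialize (Hmin (scale3 k e)). rewrite ieval_scale3, iones_scale3, He, Ho, E in Hmin.
    specialize (Hmin eq_refl). lia.
Qed.

Lemma cpx_st_spec n : (1 <= n)%nat -> st_eq (cpx_st n) (INR n).
Proof.
  intros Hn; destruct (st_eq_INR_exists n Hn) as [c Hc].
  assert (Hsp : exists a, stable (3 ^ a * n) /\
    cpx_st n = (Z.of_nat (cpx (3 ^ a * n)) - 3 * Z.of_nat a)%Z).
  { apply (epsilon_spec (inhabits 0%Z) (fun v => exists a : nat, stable (3 ^ a * n) /\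
      v = (Z.of_nat (cpx (3 ^ a * n)) - 3 * Z.of_nat a)%Z)).
    destruct (cpx_le_of_stle n c Hn) as [a Ha]; [apply Hc|].
    exists c, a. assert (E : Z.of_nat (cpx (3 ^ a * n)) = (3 * Z.of_nat a + c)%Z).
    { apply Z.le_antisymm; [apply Ha; auto|apply cpx_ge_of_st_eq; auto]. }
    split; [apply (stable_pow3_mul n c); auto|lia]. }
  destruct Hsp as (a & Hs & ->). apply (stable_pow3_mul n c) in Hs; auto.
  replace (Z.of_nat (cpx (3 ^ a * n)) - 3 * Z.of_nat a)%Z with c by lia; auto.
Qed.

Lemma div_pow3 a k : a / 3 ^ k = a * p3 (- Z.of_nat k).
Proof. rewrite p3_opp_nat; reflexivity. Qed.

Lemma INR_3 : INR 3 = 3.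
Proof. simpl; lra. Qed.

(** For the converse, a scale k is taken at which the integer x * 3 ^ k has an expression of least
    stable cost; its complexity then equals its stable cost, so it is stable. *)
Lemma T0_st_eq x : T0 x <-> st_eq 2 x.
Proof.
  split.
  - intros (n & k & Hs & Hc & ->). pose proof Hs as [Hn _].
    destruct (st_eq_INR_exists n Hn) as [c H].
    pose proof (stable_pow3_mul n c 0 Hn H) as E.
    rewrite Nat.pow_0_r, Nat.mul_1_l in E. apply E in Hs.
    rewrite div_pow3. replace 2%Z with (c + 3 * - Z.of_nat k)%Z by lia.
    apply st_eq_shift; auto.
  - intros H. pose proof H as [H1 _]. destruct (stle_large _ _ H1) as [k Hk].
    destruct (Hk k (Nat.le_refl k)) as (e & He & Hc). clear Hk.
    assert (Hst : st_eq (2 + 3 * Z.of_nat k) (INR (ieval e))) by (rewrite He; apply st_eq_shift; auto).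
    assert (Hn := ieval_pos e).
    pose proof (stable_pow3_mul _ _ 0 Hn Hst) as E.
    rewrite Nat.pow_0_r, Nat.mul_1_l in E.
    assert (Hcpx : Z.of_nat (cpx (ieval e)) = (3 * Z.of_nat 0 + (2 + 3 * Z.of_nat k))%Z).
    { destruct (cpx_spec _ Hn) as [_ Hmin]; specialize (Hmin e eq_refl).
      pose proof (cpx_ge_of_st_eq _ _ 0 Hn Hst) as Hge; rewrite Nat.pow_0_r, Nat.mul_1_l in Hge. lia. }
    exists (ieval e), k; repeat split; auto; [apply E; auto | lia|].
    rewrite div_pow3, He, Rmult_assoc, (Rmult_comm (p3 (Z.of_nat k))), p3_opp; ring.
Qed.

Lemma st_eq_approx m : forall c x eps, st_eq c x -> 0 < eps ->
  exists y, st_eq (c + Z.of_nat m) y /\ x <= y < x + eps.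
Proof.
  induction m as [|m IH]; intros c x eps H He.
  - exists x; rewrite Z.add_0_r; split; auto; lra.
  - destruct (IH c x (eps / 2)) as (y & Hy & Hxy); auto; [lra|].
    destruct (st_eq_next _ _ (eps / 2) Hy) as (z & Hz & Hyz); [lra|].
    exists z; split; [|lra]. replace (c + Z.of_nat (S m))%Z with (c + Z.of_nat m + 1)%Z by lia; auto.
Qed.

(** Points of cost below 2 are outside [T0], but [st_eq_approx] raises the cost one unit at a time
    by arbitrarily small increments, so they are limits of points of cost exactly 2. The point 0 is
    a limit of small powers of 3. *)
Lemma K0_stle0 x : K0 x <-> stle0 2 x.
Proof.
  split.
  - intros H; apply closure_stle0; intros eps He. destruct (H eps He) as (y & Hy & Hd).
    exists y; split; auto. right; apply T0_st_eq; auto.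
  - assert (G : forall x, stle 2 x -> K0 x).
    { clear x; intros x H eps He. destruct (st_eq_exists _ _ H) as (c & Hc & Hst).
      destruct (st_eq_approx (Z.to_nat (2 - c)) _ _ _ Hst He) as (y & Hy & Hxy).
      exists y; split; [|apply Rabs_def1; lra]. apply T0_st_eq.
      replace 2%Z with (c + Z.of_nat (Z.to_nat (2 - c)))%Z by lia; auto. }
    intros [->|H]; auto. intros eps He.
    destruct (stle_small 2 (eps / 2)) as (y & Hy & Hlt); [lra|].
    pose proof (stle_pos _ _ Hy). destruct (G y Hy (eps / 2)) as (z & Hz & Hd); [lra|].
    exists z; split; auto. apply Rabs_def2 in Hd; apply Rabs_def1; lra.
Qed.

Lemma derived_n_K0 u : forall x, derived_n K0 u x <-> stle0 (2 - Z.of_nat u) x.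
Proof.
  induction u as [|u IH]; intros x; [apply K0_stle0|].
  cbn [derived_n]. rewrite (derived_ext _ _ IH), derived_stle0.
  replace (2 - Z.of_nat (S u))%Z with (2 - Z.of_nat u - 1)%Z by lia; reflexivity.
Qed.

Lemma T_layer_K0 u x : T_layer K0 u x <-> st_eq (2 - Z.of_nat u) x.
Proof.
  unfold T_layer. rewrite !derived_n_K0.
  replace (2 - Z.of_nat (S u))%Z with (2 - Z.of_nat u - 1)%Z by lia.
  split; [intros [[->|H] H']; [exfalso; apply H'; left; auto|]|intros [H H']]; split; auto.
  - intros C; apply H'; right; auto.
  - right; auto.
  - intros [->|C]; auto. apply stle_pos in H; lra.
Qed.

Lemma gauge_raw_K0 n c : (1 <= n)%nat -> st_eq c (INR n) -> gauge_raw K0 (INR 3) 3 n = (c - 2)%Z.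
Proof.
  intros Hn H. unfold gauge_raw. rewrite INR_3.
  set (P := fun p : Z * nat => T_layer K0 (snd p) (INR n / powerRZ 3 (fst p))).
  assert (HP : P (epsilon (inhabits (0%Z, 0%nat)) P)).
  (* The exponent |c| is large enough for the layer index 2 - c + 3 |c| to be nonnegative. Any other
     pair gives the same value, since [st_eq] determines the cost. *)
  { apply epsilon_spec. exists (Z.abs c, Z.to_nat (2 - c + 3 * Z.abs c)); unfold P; cbn [fst snd].
    apply T_layer_K0. unfold Rdiv; rewrite <- powerRZ_neg'. rewrite Z2Nat.id by lia.
    replace (2 - (2 - c + 3 * Z.abs c))%Z with (c + 3 * - Z.abs c)%Z by lia.
    apply st_eq_shift; auto. }
  destruct (epsilon _ P) as [l u]; unfold P in HP; cbn [fst snd] in *.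
  apply T_layer_K0 in HP. unfold Rdiv in HP; rewrite <- powerRZ_neg' in HP.
  pose proof (st_eq_unique _ _ _ HP (st_eq_shift (- l) _ _ H)). lia.
Qed.

Lemma st_eq_1 : st_eq 0 (INR 1).
Proof.
  split; [apply stle_1|]. intros C; apply stle_cube in C.
  replace (0 - 1)%Z with (- (1))%Z in C by lia. pose proof (p3_opp 1). rewrite p3_1 in *. simpl in C; lra.
Qed.

Lemma gauge_K0 n c : (1 <= n)%nat -> st_eq c (INR n) -> gauge K0 (INR 3) 3 n = c.
Proof.
  intros Hn H; unfold gauge.
  rewrite (gauge_raw_K0 n c), (gauge_raw_K0 1 0); auto using st_eq_1; lia.
Qed.

(** * Positions *)

Lemma lex_lt_snoc a b x y : length a = length b ->
  (lex_lt (a ++ [x]) (b ++ [y]) <-> lex_lt a b \/ (a = b /\ (x < y)%nat)).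
Proof.
  revert b; induction a as [|u a IH]; intros [|v b] Hl; simpl in *; try discriminate.
  - split; [intros [H|[_ []]]; auto|intros [[]|[_ H]]; auto].
  - injection Hl as Hl; rewrite IH by auto. split.
    + intros [H|[-> [H|[-> H]]]]; auto.
    + intros [[H|[-> H]]|[E H]]; auto. injection E as -> ->; auto.
Qed.

Lemma lex_lt_rev_cons a b x y : length a = length b ->
  (lex_lt (rev (x :: a)) (rev (y :: b)) <-> lex_lt (rev a) (rev b) \/ (a = b /\ (x < y)%nat)).
Proof.
  intros Hl; simpl; rewrite lex_lt_snoc by (rewrite !length_rev; auto).
  split; intros [H|[E H]]; auto; right; split; auto; [|congruence].
  rewrite <- (rev_involutive a), <- (rev_involutive b), E; auto.
Qed.

Lemma lex_lt_total a b : length a = length b -> lex_lt a b \/ a = b \/ lex_lt b a.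
Proof.
  revert b; induction a as [|u a IH]; intros [|v b] Hl; simpl in *; try discriminate; auto.
  injection Hl as Hl. destruct (IH b Hl) as [H|[->|H]], (Nat.lt_total u v) as [K|[->|K]]; auto.
Qed.

Lemma ord_lt_total a b : ord_lt a b \/ a = b \/ ord_lt b a.
Proof.
  unfold ord_lt. destruct (Nat.lt_total (length a) (length b)) as [H|[H|H]]; auto.
  destruct (lex_lt_total (rev a) (rev b)) as [K|[K|K]]; auto.
  - rewrite !length_rev; auto.
  - right; left. rewrite <- (rev_involutive a), K, rev_involutive; auto.
Qed.

(** The cost bound on L makes [stle_max] available, which turns the order on the lists into a
    well-order without a separate study of ordinals. *)
Definition enumerates (c : Z) (L : R -> Prop) (t : list nat -> R) : Prop :=
  (forall x, L x -> stle c x) /\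
  (forall b, ord_ok b -> L (t b)) /\
  (forall x, L x -> exists b, ord_ok b /\ t b = x) /\
  (forall a b, ord_ok a -> ord_ok b -> ord_lt a b -> t b < t a).

Lemma enum_ord_lt c L t a b : enumerates c L t -> ord_ok a -> ord_ok b -> t b < t a -> ord_lt a b.
Proof.
  intros (_ & _ & _ & t_lt) Ha Hb H. destruct (ord_lt_total a b) as [K|[->|K]]; auto; [lra|].
  pose proof (t_lt _ _ Hb Ha K); lra.
Qed.

(** A least counterexample is one whose image under t is largest, and [stle_max] provides it. *)
Lemma enum_ind c L t (P : list nat -> Prop) : enumerates c L t ->
  (forall b, ord_ok b -> (forall a, ord_ok a -> ord_lt a b -> P a) -> P b) ->
  forall b, ord_ok b -> P b.
Proof.
  intros (L_stle & t_mem & _ & t_lt) H b Hb; apply NNPP; intros C.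
  destruct (stle_max c (fun x => exists b, ord_ok b /\ ~ P b /\ t b = x)) as (m & (d & Hd & Hn & <-) & Hm).
  - intros x (d & Hd & _ & <-); auto.
  - exists (t b), b; auto.
  - apply Hn, H; auto. intros a Ha Hlt; apply NNPP; intros Hna.
    pose proof (t_lt _ _ Ha Hd Hlt). assert (t a <= t d) by (apply Hm; exists a; auto). lra.
Qed.

Lemma at_position_enum c L t a : enumerates c L t -> ord_ok a -> at_position L a (t a).
Proof.
  intros He Ha; pose proof He as (L_stle & t_mem & t_surj & t_lt); split; auto. exists t; repeat split; auto.
  - intros y Hy Hlt; destruct (t_surj y Hy) as (b & Hb & <-); exists b; repeat split; auto.
    apply (enum_ord_lt c L t); auto.
Qed.

Lemma at_position_eq c L t a x : enumerates c L t -> ord_ok a -> at_position L a x -> x = t a.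
Proof.
  intros Henum Ha (Lx & g & Hg & Hsurj & Hdec).
  pose proof Henum as (L_stle & t_mem & t_surj & t_lt).
  destruct (t_surj x Lx) as (b & Hb & <-).
  (* Two decreasing enumerations of upper parts of L agree on their common initial segment;
     comparing a with b then excludes a <> b. *)
  assert (E : forall d, ord_ok d -> ord_lt d a -> ord_lt d b -> g d = t d).
  { intros d Hd; pattern d; apply (enum_ind c L t); auto; clear d Hd.
    intros d Hd IH Hda Hdb.
    destruct (Hg d Hd Hda) as [Lg Hlt]. destruct (t_surj _ Lg) as (e & He & Ee).
    destruct (ord_lt_total d e) as [K|[->|K]]; auto.
    - destruct (Hsurj (t d)) as (f & Hf & Hfa & Ef); auto.
      destruct (ord_lt_total d f) as [M|[<-|M]]; auto.
      + pose proof (Hdec _ _ Hd Hf M Hfa). pose proof (t_lt _ _ Hd He K). lra.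
      + assert (Hda' : ord_lt f a) by auto. pose proof (t_lt _ _ Hf Hd M).
        assert (g f = t f); [|lra]. apply IH; auto.
        apply (enum_ord_lt c L t); auto. pose proof (t_lt _ _ Hd Hb Hdb); lra.
    - pose proof (t_lt _ _ He Hd K). pose proof (t_lt _ _ Hd Ha Hda).
      pose proof (Hdec _ _ He Hd K Hda). assert (g e = t e); [|lra].
      apply IH; auto; apply (enum_ord_lt c L t); auto; lra. }
  destruct (ord_lt_total a b) as [K|[->|K]]; auto.
  - destruct (Hsurj (t a)) as (d & Hd & Hda & Ed); auto.
    pose proof (t_lt _ _ Hd Ha Hda). assert (g d = t d); [|lra].
    pose proof (t_lt _ _ Ha Hb K). apply E; auto; apply (enum_ord_lt c L t); auto; lra.
  - destruct (Hg b Hb K) as [Lg Hlt]. destruct (t_surj _ Lg) as (d & Hd & Ed).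
    assert (Hdb : ord_lt d b) by (apply (enum_ord_lt c L t); auto; lra).
    pose proof (t_lt _ _ Hd Hb Hdb). pose proof (t_lt _ _ Hb Ha K).
    assert (Hda : ord_lt d a) by (apply (enum_ord_lt c L t); auto; lra).
    pose proof (Hdec _ _ Hd Hb Hdb K). rewrite (E d) in H1; auto. lra.
Qed.

(** * Successors and Cantor normal forms *)

Definition level (u : nat) (x : R) : Prop := stle (2 - Z.of_nat u) x.

Lemma level_weaken u v x : (u <= v)%nat -> level v x -> level u x.
Proof. intros H; apply stle_weaken; lia. Qed.

Lemma level_pos u x : level u x -> 0 < x.
Proof. apply stle_pos. Qed.

Lemma level_lt_3 u x : level u x -> x < 3.
Proof.
  intros H. pose proof (level_pos _ _ H). apply (level_weaken 0) in H; [|lia].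
  apply stle_cube in H. apply Rnot_le_lt; intros C. apply (cube_le 3) in C; [|lra].
  unfold p3 in H; simpl in H, C; lra.
Qed.

Lemma level_accumulation u z X : level (S u) z -> z < X -> exists y, level u y /\ z < y < X.
Proof.
  intros H Hz. destruct (accumulation_intro (2 - Z.of_nat u) z (X - z)) as (y & Hy & Hzy).
  - replace (2 - Z.of_nat u - 1)%Z with (2 - Z.of_nat (S u))%Z by lia; auto.
  - lra.
  - exists y; split; auto; lra.
Qed.

Definition is_nxt (u : nat) (X m : R) : Prop :=
  level u m /\ m < X /\ forall y, level u y -> y < X -> y <= m.

Definition nxt (u : nat) (X : R) : R := epsilon (inhabits 0) (is_nxt u X).

Lemma nxt_spec u X : 0 < X -> is_nxt u X (nxt u X).
Proof.
  intros HX; unfold nxt; apply epsilon_spec.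
  destruct (stle_max (2 - Z.of_nat u) (fun x => level u x /\ x < X)) as (m & [Hm HmX] & Hmax).
  - intros x [H _]; auto.
  - apply stle_small; auto.
  - exists m; repeat split; auto.
Qed.

(** Points of level [S u] are limits from above of points of level u, so a step of level u never
    reaches one, and neither do finitely many steps. *)
Lemma nxt_gt u z X : level (S u) z -> z < X -> z < nxt u X.
Proof.
  intros H Hz. destruct (level_accumulation _ _ _ H Hz) as (y & Hy & Hzy).
  pose proof (level_pos _ _ H). destruct (nxt_spec u X) as (_ & _ & Hmax); [lra|].
  specialize (Hmax y Hy); lra.
Qed.

Lemma nxt_exact u X : 0 < X -> st_eq (2 - Z.of_nat u) (nxt u X).
Proof.
  intros HX; destruct (nxt_spec u X HX) as (Hm & Hlt & _). split; auto.
  intros C. assert (C' : level (S u) (nxt u X)).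
  { unfold level; replace (2 - Z.of_nat (S u))%Z with (2 - Z.of_nat u - 1)%Z by lia; auto. }
  pose proof (nxt_gt _ _ _ C' Hlt); lra.
Qed.

Definition nxt_iter (u r : nat) (X : R) : R := Nat.iter r (nxt u) X.

Lemma nxt_iter_pos u r X : 0 < X -> 0 < nxt_iter u r X.
Proof.
  intros HX; induction r as [|r IH]; auto. simpl.
  destruct (nxt_spec u (nxt_iter u r X) IH) as (H & _); eapply level_pos; eauto.
Qed.

Lemma nxt_iter_level u r X : 0 < X -> level u (nxt_iter u (S r) X).
Proof. intros HX; apply (nxt_spec u (nxt_iter u r X)), nxt_iter_pos; auto. Qed.

Lemma nxt_iter_decr u r X : 0 < X -> nxt_iter u (S r) X < nxt_iter u r X.
Proof. intros HX; apply (nxt_spec u (nxt_iter u r X)), nxt_iter_pos; auto. Qed.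

Lemma nxt_iter_le u r s X : 0 < X -> (r <= s)%nat -> nxt_iter u s X <= nxt_iter u r X.
Proof.
  intros HX H; induction H as [|s H IH]; [lra|].
  pose proof (nxt_iter_decr u s X HX); lra.
Qed.

Lemma nxt_iter_gt u r z X : level (S u) z -> z < X -> z < nxt_iter u r X.
Proof.
  intros H Hz; induction r as [|r IH]; auto. simpl; apply nxt_gt; auto.
Qed.

(* The iterates converge to an element of level [S u] (or to 0), hence to at
   most the largest such element below [X]. *)
Lemma nxt_iter_below u X x : 0 < X -> nxt (S u) X < x -> exists r, nxt_iter u r X < x.
Proof.
  intros HX Hx. apply NNPP; intros C.
  assert (Hge : forall r, x <= nxt_iter u r X).
  { intros r; apply Rnot_lt_le; intros H; apply C; exists r; auto. }
  destruct (nxt_spec (S u) X HX) as (Hn & _ & Hmax). apply level_pos in Hn.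
  set (v r := nxt_iter u r X).
  destruct (decreasing_cv v) as [l Hl].
  { intros r; left; apply nxt_iter_decr; auto. }
  { exists (- x); intros y [r Hr]; rewrite Hr; unfold opp_seq. specialize (Hge r); fold (v r) in Hge; lra. }
  assert (Hlv : forall r, l <= v r).
  { intros r; apply (decreasing_ineq v l); auto. intros i; left; apply nxt_iter_decr; auto. }
  assert (Hlx : x <= l).
  { apply Rnot_lt_le; intros Hlt. destruct (Hl (x - l)) as [N HN]; [lra|].
    specialize (HN N (Nat.le_refl N)). unfold Rdist in HN; apply Rabs_def2 in HN.
    specialize (Hge N); unfold v in HN; lra. }
  assert (Hll : level (S u) l).
  { unfold level; replace (2 - Z.of_nat (S u))%Z with (2 - Z.of_nat u - 1)%Z by lia.
    apply accumulation_stle; [lra|]. intros eps He. destruct (Hl eps He) as [N HN].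
    exists (v (S N)); repeat split.
    - apply nxt_iter_level; auto.
    - pose proof (nxt_iter_decr u (S N) X HX). specialize (Hlv (S (S N))). unfold v in *; lra.
    - apply HN; lia. }
  assert (l < X) by (pose proof (nxt_iter_decr u 0 X HX); specialize (Hlv 1%nat); unfold v in Hlv; simpl in *; lra).
  specialize (Hmax l Hll H); lra.
Qed.

Lemma nxt_iter_between u X x : 0 < X -> nxt (S u) X < x -> x <= X ->
  exists r, nxt_iter u (S r) X < x <= nxt_iter u r X.
Proof.
  intros HX Hx HxX.
  destruct (dec_inh_nat_subset_has_unique_least_element (fun r => nxt_iter u r X < x))
    as (r & [Hr Hmin] & _).
  - intros; apply classic.
  - apply nxt_iter_below; auto.
  - destruct r as [|r]; [simpl in Hr; lra|].
    exists r; split; auto. apply Rnot_lt_le; intros C; specialize (Hmin r C); lia.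
Qed.

Lemma level_between u X x : 0 < X -> level u x -> nxt (S u) X < x -> x < X ->
  exists r, x = nxt_iter u (S r) X.
Proof.
  intros HX Hx H1 H2. destruct (nxt_iter_between u X x) as (r & Hr & Hle); auto; [lra|].
  destruct Hle as [Hlt| ->].
  - destruct (nxt_spec u (nxt_iter u r X)) as (_ & _ & Hmax); [apply nxt_iter_pos; auto|].
    specialize (Hmax x Hx Hlt). simpl in Hr; lra.
  - destruct r as [|r]; [simpl in H2; lra|]. exists r; auto.
Qed.

(* Below [X], the element of level [u] with Cantor normal form
   [c_0 + omega c_1 + ...]: skip [c_i] elements of level [u + i], the highest
   levels first. *)
Fixpoint cnf_from (u : nat) (l : list nat) (X : R) : R :=
  match l with
  | [] => X
  | r :: l' => nxt_iter u r (cnf_from (S u) l' X)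
  end.

(* 3 exceeds every element of [K0]. *)
Definition cnf (u : nat) (l : list nat) : R := cnf_from u l 3.

Lemma cnf_from_pos l : forall u X, 0 < X -> 0 < cnf_from u l X.
Proof. induction l as [|r l IH]; intros u X HX; simpl; auto using nxt_iter_pos. Qed.

Lemma cnf_pos u l : 0 < cnf u l.
Proof. apply cnf_from_pos; lra. Qed.

Lemma cnf_from_snoc l : forall u X r,
  cnf_from u (l ++ [r]) X = cnf_from u l (nxt_iter (u + length l) r X).
Proof.
  induction l as [|s l IH]; intros u X r; simpl; [rewrite Nat.add_0_r; auto|].
  rewrite IH. do 3 f_equal; lia.
Qed.

(** Coefficients are found from the highest level down: take r steps of level u + m such that one
    more would pass below x, then continue from the point reached with one level less. *)
Lemma cnf_from_surj m : forall u X x, 0 < X -> level u x -> nxt (u + m) X < x -> x <= X ->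
  exists l, cnf_from u l X = x /\ length l = m.
Proof.
  induction m as [|m IH]; intros u X x HX Hx H1 H2.
  - exists []; split; auto. simpl. rewrite Nat.add_0_r in H1.
    destruct H2 as [H2|]; auto. destruct (nxt_spec u X HX) as (_ & _ & Hmax).
    specialize (Hmax x Hx H2); lra.
  - replace (u + S m)%nat with (S (u + m)) in H1 by lia.
    destruct (nxt_iter_between (u + m) X x) as (r & Hr & Hle); auto.
    destruct (IH u (nxt_iter (u + m) r X) x) as (l & El & Hl); auto using nxt_iter_pos.
    exists (l ++ [r]); rewrite cnf_from_snoc, Hl, length_app; split; auto; simpl; lia.
Qed.

(** Elements of level m have cube at most 3 ^ (2 - m), so finitely many coefficients suffice to
    reach x. *)
Lemma level_bounded x : 0 < x -> exists m, nxt m 3 < x.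
Proof.
  intros Hx. destruct (p3_small (x ^ 3)) as [K HK]; [apply pow_lt; auto|].
  exists (K + 2)%nat. destruct (nxt_spec (K + 2) 3) as (H & _ & _); [lra|].
  apply stle_cube in H. apply Rnot_le_lt; intros C; apply cube_le in C; [|lra].
  replace (2 - Z.of_nat (K + 2))%Z with (- Z.of_nat K)%Z in H by lia. lra.
Qed.

Lemma cnf_surj u x : level u x -> exists l, cnf u l = x.
Proof.
  intros H. destruct (level_bounded x) as [m Hm]; [eapply level_pos; eauto|].
  destruct (cnf_from_surj m u 3 x) as (l & El & _); auto; try lra.
  - destruct (nxt_spec (u + m) 3) as (Hl & Hl3 & _); [lra|].
    destruct (nxt_spec m 3) as (_ & _ & Hmax); [lra|].
    apply (level_weaken m) in Hl; [|lia]. specialize (Hmax _ Hl Hl3); lra.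
  - apply level_lt_3 in H; lra.
  - exists l; auto.
Qed.

Lemma cnf_normalize l : exists l', ord_ok l' /\ forall u, cnf u l' = cnf u l.
Proof.
  induction l as [|r l (l' & Hok & E)]; [exists []; split; auto; left; auto|].
  destruct l' as [|s l'].
  - destruct r as [|r].
    + exists []; split; [left; auto|]. intros u. change (cnf u (0%nat :: l)) with (cnf (S u) l).
      rewrite <- E; auto.
    + exists [S r]; split; [right; simpl; lia|]. intros u.
      change (cnf u (S r :: l)) with (nxt_iter u (S r) (cnf (S u) l)). rewrite <- E; auto.
  - exists (r :: s :: l'); split.
    + destruct Hok as [Hok|Hok]; [discriminate|right; auto].
    + intros u. change (cnf u (r :: l)) with (nxt_iter u r (cnf (S u) l)). rewrite <- E; auto.
Qed.

Lemma ord_ok_tail r l : l <> [] -> ord_ok (r :: l) -> ord_ok l.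
Proof.
  intros Hl [H|H]; [discriminate|]. right. destruct l; [congruence|auto].
Qed.

Lemma cnf_step u X r l : 0 < X -> cnf (S u) l <= nxt (S u) X ->
  cnf u (r :: l) <= nxt u X.
Proof.
  intros HX H. change (cnf u (r :: l)) with (nxt_iter u r (cnf (S u) l)).
  pose proof (nxt_iter_le u 0 r _ (cnf_pos (S u) l) (Nat.le_0_l r)) as H1. simpl in H1.
  destruct (nxt_spec (S u) X HX) as (Hz & HzX & _).
  pose proof (nxt_gt _ _ _ Hz HzX). lra.
Qed.

Lemma cnf_step_cons u r s a b : cnf (S u) b <= nxt (S u) (cnf (S u) a) ->
  cnf u (s :: b) <= nxt u (cnf u (r :: a)).
Proof.
  intros H. change (cnf u (s :: b)) with (nxt_iter u s (cnf (S u) b)).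
  change (cnf u (r :: a)) with (nxt_iter u r (cnf (S u) a)).
  assert (H1 : nxt_iter u s (cnf (S u) b) <= cnf (S u) b)
    by exact (nxt_iter_le u 0 s _ (cnf_pos (S u) b) (Nat.le_0_l s)).
  destruct (nxt_spec (S u) (cnf (S u) a) (cnf_pos _ _)) as (Hz & HzX & _).
  assert (H2 : nxt (S u) (cnf (S u) a) < nxt u (nxt_iter u r (cnf (S u) a)))
    by exact (nxt_iter_gt u (S r) _ _ Hz HzX).
  lra.
Qed.

(** The highest coefficients decide. If the tails differ, the induction hypothesis places the tail
    of b at or below a point of level [S u] lying under the tail of a, and no finite number of steps
    of level u from the tail of a descends to that point. *)
Lemma cnf_le_nxt a : forall b u, ord_ok b -> ord_lt a b -> cnf u b <= nxt u (cnf u a).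
Proof.
  induction a as [|r a IH]; intros b u Hb Hab.
  - assert (G : forall b u, ord_ok b -> b <> [] -> cnf u b <= nxt u 3).
    { clear; induction b as [|s b IH]; intros u Hb Hne; [congruence|].
      destruct b as [|s' b].
      - destruct Hb as [Hb|Hb]; [discriminate|]. simpl in Hb. destruct s as [|s]; [lia|].
        apply (nxt_iter_le u 1 (S s) 3); [lra|lia].
      - apply cnf_step; [lra|]. apply IH; [eapply ord_ok_tail; eauto|]; discriminate. }
    apply G; auto. destruct Hab as [H|[_ H]]; [intros ->; simpl in H; lia|].
    intros ->; exact H.
  - destruct b as [|s b]; [destruct Hab as [H|[H _]]; simpl in H; lia|].
    assert (Htail : ord_lt a b -> cnf u (s :: b) <= nxt u (cnf u (r :: a))).
    { intros H. apply cnf_step_cons, IH; auto. apply (ord_ok_tail s); auto.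
      intros ->. destruct H as [H|[H H']]; [simpl in H; lia|].
      destruct a; [exact H'|discriminate]. }
    destruct Hab as [H|[H H']].
    + apply Htail; left; simpl in H; lia.
    + simpl in H; injection H as H. apply lex_lt_rev_cons in H'; auto.
      destruct H' as [H'|[-> Hrs]]; [apply Htail; right; auto|].
      apply (nxt_iter_le u (S r) s (cnf (S u) b)); auto using cnf_pos.
Qed.

(** In the enumeration of level u that starts with the artificial top 3, limit positions carry the
    points of level [S u], and exact level u means successor position. The successors up to alpha +
    1 are the beta + 1 with beta <= alpha, so the element at alpha + 1 has position alpha inside the
    layer. *)
Definition cnf_succ (u : nat) (l : list nat) : R := nxt u (cnf u l).

Lemma cnf_succ_lt u a b : ord_ok b -> ord_lt a b -> cnf_succ u b < cnf_succ u a.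
Proof.
  intros Hb H. pose proof (cnf_le_nxt a b u Hb H).
  destruct (nxt_spec u (cnf u b)) as (_ & H1 & _); [apply cnf_pos|].
  unfold cnf_succ; lra.
Qed.

Lemma cnf_zero_level u l : level (S u) (cnf (S u) l) \/ cnf (S u) l = 3.
Proof.
  revert u; induction l as [|r l IH]; intros u; [right; auto|].
  change (cnf (S u) (r :: l)) with (nxt_iter (S u) r (cnf (S (S u)) l)).
  destruct r as [|r].
  - destruct (IH (S u)) as [H|H]; auto. left; eapply level_weaken; [|apply H]; lia.
  - left; apply nxt_iter_level, cnf_pos.
Qed.

Lemma cnf_succ_surj u x : st_eq (2 - Z.of_nat u) x -> exists l, ord_ok l /\ cnf_succ u l = x.
Proof.
  intros [H H']. destruct (cnf_surj u x H) as [l E].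
  assert (Hx3 : x < 3) by (eapply level_lt_3; eauto).
  (* The empty list gives the top 3, and a coefficient c_0 = 0 would give 3 or a point of level
     [S u], against exactness; hence c_0 is a successor. *)
  destruct l as [|[|r] l]; [unfold cnf in E; simpl in E; lra| |].
  - exfalso. change (cnf (S u) l = x) in E. destruct (cnf_zero_level u l) as [K|K]; [|lra].
    apply H'; rewrite <- E. unfold level in K.
    replace (2 - Z.of_nat u - 1)%Z with (2 - Z.of_nat (S u))%Z by lia; auto.
  - destruct (cnf_normalize (r :: l)) as (l' & Hok & E').
    exists l'; split; auto. unfold cnf_succ; rewrite E'; auto.
Qed.

Lemma cnf_succ_enumerates u : enumerates (2 - Z.of_nat u) (T_layer K0 u) (cnf_succ u).
Proof.
  split; [|split; [|split]].
  - intros x Hx; apply T_layer_K0, Hx.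
  - intros b _; apply T_layer_K0, nxt_exact, cnf_pos.
  - intros x Hx; apply cnf_succ_surj, T_layer_K0, Hx.
  - intros; apply cnf_succ_lt; auto.
Qed.

Lemma T_layer_at_position u a x : ord_ok a ->
  (at_position (T_layer K0 u) a x <-> x = cnf_succ u a).
Proof.
  intros Ha; pose proof (cnf_succ_enumerates u) as H.
  split; [eapply at_position_eq; eauto|intros ->; eapply at_position_enum; eauto].
Qed.

(* [cnf 0] enumerates [K0 \ {0}] from position 1, since [cnf 0 []] is the
   artificial top 3; this is the shift [1 + alpha]. *)
Definition one_plus (l : list nat) : list nat :=
  match l with
  | [] => [1%nat]
  | [r] => [S r]
  | _ => l
  end.

Lemma one_plus_ok l : ord_ok l -> ord_ok (one_plus l).
Proof.
  intros H; destruct l as [|r [|s l]]; simpl; auto; right; simpl; lia.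
Qed.

Lemma one_plus_lt a b : ord_ok b -> ord_lt a b -> ord_lt (one_plus a) (one_plus b).
Proof.
  unfold ord_lt, ord_ok; intros Hb H.
  destruct a as [|r [|r' a]], b as [|s [|s' b]]; simpl in *; try lia; auto.
  - destruct H as [H|[H H']]; [|lia]. right; split; auto. destruct Hb as [Hb|Hb]; [discriminate|]. left; lia.
Qed.

Lemma one_plus_surj l : ord_ok l -> l <> [] -> exists l', ord_ok l' /\ one_plus l' = l.
Proof.
  intros H Hne. destruct l as [|r [|s l]]; [congruence| |exists (r :: s :: l); auto].
  destruct H as [H|H]; [discriminate|]. simpl in H.
  destruct r as [|[|r]]; [lia|exists []; split; auto; left; auto|].
  exists [S r]; split; auto; right; simpl; lia.
Qed.

Lemma K0_order_type : order_type_ww_plus_1 K0.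
Proof.
  set (f := fun o => match o with Some l => cnf 0 (one_plus l) | None => 0 end).
  assert (Hlt : forall l, ord_ok l -> cnf 0 (one_plus l) < 3 /\ level 0 (cnf 0 (one_plus l))).
  { intros l Hl. assert (H : cnf 0 (one_plus l) < 3).
    { apply Rle_lt_trans with (nxt 0 3).
      - apply (cnf_le_nxt []); [apply one_plus_ok; auto|].
        left; destruct l as [|r [|s l]]; simpl; lia.
      - apply nxt_spec; lra. }
    split; auto. assert (Hne : one_plus l <> []) by (destruct l as [|r [|s l]]; discriminate).
    destruct (one_plus l) as [|[|r] l']; [congruence| |].
    - change (cnf 0 (0%nat :: l')) with (cnf 1 l') in *.
      destruct (cnf_zero_level 0 l') as [K|K]; [|lra]. eapply level_weaken; [|apply K]; lia.
    - apply (nxt_iter_level 0 r), cnf_pos. }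
  exists f; split; [|split].
  - intros [l|] H; apply K0_stle0; [right; apply Hlt; auto|left; auto].
  - intros x Hx; apply K0_stle0 in Hx; destruct Hx as [->|Hx]; [exists None; split; simpl; auto|].
    destruct (cnf_surj 0 x Hx) as [l E]. destruct (cnf_normalize l) as (l' & Hok & E').
    destruct (one_plus_surj l' Hok) as (l'' & Hok' & E'').
    + intros ->. specialize (E' 0%nat). apply (level_lt_3 0) in Hx. unfold cnf at 1 in E'. simpl in E'. lra.
    + exists (Some l''); split; auto. simpl; rewrite E'', E'; auto.
  - intros [a|] [b|] Ha Hb Hab; simpl in *; try contradiction.
    + pose proof (cnf_le_nxt (one_plus a) (one_plus b) 0 (one_plus_ok _ Hb) (one_plus_lt _ _ Hb Hab)).
      destruct (nxt_spec 0 (cnf 0 (one_plus a))) as (_ & ? & _); [apply cnf_pos|]. lra.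
    + apply cnf_pos.
Qed.

(** * Arithmeticity *)

Lemma nat_pow3_factor N : (1 <= N)%nat ->
  exists m j : nat, (1 <= m)%nat /\ ~ Nat.divide 3 m /\ N = (m * 3 ^ j)%nat.
Proof.
  induction N as [N IH] using (well_founded_induction lt_wf). intros HN.
  destruct (classic (Nat.divide 3 N)) as [[q Hq]|H].
  - destruct (IH q) as (m & j & Hm & Hd & E); [lia|lia|].
    exists m, (S j); repeat split; auto. rewrite Hq, E; simpl; lia.
  - exists N, 0%nat; repeat split; auto. simpl; lia.
Qed.

Lemma stle_factor c x : stle c x ->
  exists (m : nat) (k : Z), (1 <= m)%nat /\ ~ Nat.divide 3 m /\ x = INR m * p3 k.
Proof.
  intros (e & k & -> & _). destruct (nat_pow3_factor (ieval e) (ieval_pos e)) as (m & j & Hm & Hd & ->).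
  exists m, (Z.of_nat j - k)%Z; repeat split; auto.
  rewrite mult_INR, INR_pow3, Rmult_assoc, <- p3_add; do 2 f_equal; lia.
Qed.

Lemma pow3_factor_unique m m' k k' : ~ Nat.divide 3 m -> ~ Nat.divide 3 m' ->
  INR m * p3 k = INR m' * p3 k' -> m = m' /\ k = k'.
Proof.
  assert (G : forall m m' k k', (k <= k')%Z -> ~ Nat.divide 3 m ->
    INR m * p3 k = INR m' * p3 k' -> m = m' /\ k = k').
  { clear; intros m m' k k' Hk Hm E.
    assert (E' : m = (m' * 3 ^ Z.to_nat (k' - k))%nat).
    { apply INR_eq. rewrite mult_INR, INR_pow3, Z2Nat.id by lia.
      apply Rmult_eq_reg_r with (p3 k); [|pose proof (p3_pos k); lra].
      rewrite E, Rmult_assoc, <- p3_add; do 2 f_equal; lia. }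
    destruct (Z.eq_dec k k') as [->|Hne].
    - rewrite Z.sub_diag in E'; simpl in E'; split; auto; lia.
    - exfalso; apply Hm. exists (m' * 3 ^ (Z.to_nat (k' - k) - 1))%nat.
      rewrite E'. replace (Z.to_nat (k' - k)) with (S (Z.to_nat (k' - k) - 1)) at 1 by lia.
      simpl; lia. }
  intros Hm Hm' E. destruct (Z_le_gt_dec k k').
  - apply G; auto.
  - destruct (G m' m k' k); auto; lia.
Qed.

Lemma not_divide3_mul a b : ~ Nat.divide 3 a -> ~ Nat.divide 3 b -> ~ Nat.divide 3 (a * b).
Proof.
  intros Ha Hb [q Hq].
  assert (H : forall n, ~ Nat.divide 3 n -> (n mod 3 = 1 \/ n mod 3 = 2)%nat).
  { intros n Hn. pose proof (Nat.mod_upper_bound n 3).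
    assert (n mod 3 <> 0)%nat; [|lia]. intros C; apply Hn, Nat.Lcm0.mod_divide; auto. }
  assert (E : ((a * b) mod 3 = 0)%nat) by (rewrite Hq; apply Nat.Div0.mod_mul).
  rewrite Nat.Div0.mul_mod in E.
  destruct (H a Ha) as [Ea|Ea], (H b Hb) as [Eb|Eb]; rewrite Ea, Eb in E; discriminate.
Qed.

Lemma K0_compact : compact K0.
Proof.
  apply compact_P5.
  - intros x Hx. assert (H : ~ closure_R (stle0 2) x).
    { intros C; apply Hx, K0_stle0, closure_stle0, C. }
    apply not_all_ex_not in H; destruct H as [eps H]. apply imply_to_and in H; destruct H as [He H].
    exists (mkposreal eps He); intros y Hy C. apply H; exists y; split; [apply K0_stle0; auto|exact Hy].
  - exists 0, 3; intros x Hx; apply K0_stle0 in Hx. split; [eapply stle0_nonneg; eauto|].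
    destruct Hx as [->|Hx]; [lra|]. left; apply (level_lt_3 0); auto.
Qed.

Lemma K0_rev_well_ordered : rev_well_ordered K0.
Proof.
  intros S HS [x0 Hx0]. destruct (classic (exists x, S x /\ stle 2 x)) as [H|H].
  - destruct (stle_max 2 (fun x => S x /\ stle 2 x)) as (m & [Hm Hm'] & Hmax); auto.
    { intros x [_ ?]; auto. }
    exists m; split; auto. intros y Hy. pose proof (HS y Hy) as Ky; apply K0_stle0 in Ky.
    destruct Ky as [->|Ky]; auto. left; eapply stle_pos; eauto.
  - assert (E : forall y, S y -> y = 0).
    { intros y Hy. pose proof (HS y Hy) as Ky; apply K0_stle0 in Ky.
      destruct Ky as [|Ky]; auto. exfalso; apply H; exists y; auto. }
    exists x0; split; auto. intros y Hy; rewrite (E y Hy), (E x0 Hx0); lra.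
Qed.

Lemma K0_self_similar : self_similar_compact K0 (INR 3) 3.
Proof.
  rewrite INR_3. split; [lra|]. split; [lia|]. split; [apply K0_compact|].
  split; [intros x Hx; apply K0_stle0 in Hx; eapply stle0_nonneg; eauto|].
  split; [|split; [apply K0_rev_well_ordered|apply K0_order_type]].
  intros x; rewrite K0_stle0. split.
  - intros H; exists (x * p3 (- (1))). split.
    + apply (derived_n_K0 3). destruct H as [->|H]; [left; ring|right].
      apply (stle_shift (- (1))) in H; auto.
    + pose proof (p3_opp 1) as E; rewrite p3_1 in E.
      transitivity (x * (p3 (- (1)) * 3)); [rewrite E|]; ring.
  - intros (y & Hy & ->). apply (derived_n_K0 3) in Hy. destruct Hy as [->|Hy]; [left; ring|right].
    apply (stle_shift 1) in Hy. rewrite p3_1, Rmult_comm in Hy; auto.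
Qed.

Lemma K0_quasi_arithmetic : quasi_arithmetic K0 3 3.
Proof.
  split; [apply K0_self_similar|]. split; [lia|]. rewrite INR_3.
  assert (Hk : forall m : nat, exists k0 : nat, forall k : nat, (1 <= m)%nat ->
    ((k0 <= k)%nat <-> stle 2 (INR m / 3 ^ k))).
  { intros m. destruct (le_lt_dec 1 m) as [Hm|Hm]; [|exists 0%nat; lia].
    destruct (st_eq_INR_exists m Hm) as [c Hc].
    (* The condition c <= 3 k + 2 is equivalent to floor(c / 3) <= k; a negative quotient is
       truncated to 0. *)
    exists (Z.to_nat (c / 3)); intros k _. rewrite div_pow3.
    assert (E : stle 2 (INR m * p3 (- Z.of_nat k)) <-> (c <= 2 + 3 * Z.of_nat k)%Z).
    { pose proof (st_eq_shift (- Z.of_nat k) _ _ Hc) as Hs. split; intros H.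
      - pose proof (st_eq_le _ _ _ Hs H); lia.
      - eapply stle_weaken; [|apply Hs]; lia. }
    rewrite E. pose proof (Z.div_mod c 3); pose proof (Z.mod_pos_bound c 3). lia. }
  apply functional_choice in Hk; destruct Hk as [kappa Hkappa].
  exists kappa; intros x; rewrite K0_stle0; split.
  - intros [[->|H] Hx]; [congruence|].
    destruct (stle_factor _ _ H) as (m & j & Hm & Hd & E).
    (* The exponent cannot be positive, because m >= 1 and every element of [K0] is below 3. *)
    assert (Hj : (j < 1)%Z).
    { apply p3_lt_inv; rewrite p3_1. apply (le_INR 1) in Hm; simpl in Hm.
      pose proof (level_lt_3 0 x H). pose proof (p3_pos j). nra. }
    exists m, (Z.to_nat (- j)). rewrite div_pow3.
    assert (E' : x = INR m * p3 (- Z.of_nat (Z.to_nat (- j)))) by (rewrite E; do 2 f_equal; lia).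
    repeat split; auto. apply Hkappa; auto. rewrite div_pow3, <- E'; auto.
  - intros (m & k & Hm & Hd & Hk & ->). apply Hkappa in Hk; auto.
    split; [right; auto|]. pose proof (stle_pos _ _ Hk); lra.
Qed.

Lemma finite_R_incl (A B : R -> Prop) : (forall x, A x -> B x) -> finite_R B -> finite_R A.
Proof. intros H [l Hl]; exists l; auto. Qed.

Lemma finite_R_or (A B : R -> Prop) : finite_R A -> finite_R B -> finite_R (fun x => A x \/ B x).
Proof.
  intros [l Hl] [m Hm]; exists (l ++ m); intros x [H|H]; apply in_or_app; auto.
Qed.

Lemma finite_R_image (f : nat -> R) N : finite_R (fun x => exists i, (i < N)%nat /\ x = f i).
Proof.
  exists (map f (seq 0 N)); intros x (i & Hi & ->). apply in_map, in_seq; lia.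
Qed.

Lemma finite_R_bounded_union (F : nat -> R -> Prop) N : (forall i, finite_R (F i)) ->
  finite_R (fun x => exists i, (i <= N)%nat /\ F i x).
Proof.
  intros H; induction N as [|N IH].
  - apply finite_R_incl with (F 0%nat); auto. intros x (i & Hi & Hx).
    replace 0%nat with i by lia; auto.
  - apply finite_R_incl with (fun x => (exists i, (i <= N)%nat /\ F i x) \/ F (S N) x).
    + intros x (i & Hi & Hx). destruct (Nat.eq_dec i (S N)) as [->|]; auto.
      left; exists i; split; auto; lia.
    + apply finite_R_or; auto.
Qed.

Lemma st_eq_mul_inv ca cb a b : stle ca a -> stle cb b -> st_eq (ca + cb) (a * b) ->
  st_eq ca a /\ st_eq cb b.
Proof.
  intros Ha Hb [_ H]; repeat split; auto; intros C; apply H.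
  - replace (ca + cb - 1)%Z with (ca - 1 + cb)%Z by lia; apply stle_mul; auto.
  - replace (ca + cb - 1)%Z with (ca + (cb - 1))%Z by lia; apply stle_mul; auto.
Qed.

Definition branch (k a b r : nat) : R := INR b * (INR a * INR 3 ^ r + 1) / INR 3 ^ (r + k).

Lemma branch_eq k a b r :
  branch k a b r = INR b * (INR a + p3 (- Z.of_nat r)) * p3 (- Z.of_nat k).
Proof.
  unfold branch. rewrite INR_3, div_pow3.
  replace (- Z.of_nat (r + k))%Z with (- Z.of_nat r + - Z.of_nat k)%Z by lia.
  rewrite p3_add, <- p3_nat. pose proof (p3_opp (Z.of_nat r)).
  transitivity (INR b * (INR a * (p3 (- Z.of_nat r) * p3 (Z.of_nat r)) + p3 (- Z.of_nat r)) * p3 (- Z.of_nat k));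
    [ring|rewrite H; ring].
Qed.

(** Powers of 3 are removed from both factors of the spike. As 3 is prime, the remaining parts
    multiply to n and the exponents add up to - k; additivity of the costs of the spike becomes
    additivity of the gauge. *)
Lemma spike_branch c n k x y : (1 <= n)%nat -> ~ Nat.divide 3 n -> x = INR n / INR 3 ^ k ->
  st_eq (c - 1) x -> spike c x y -> y < x + p3 (- Z.of_nat k) ->
  exists a b r : nat, (1 <= a)%nat /\ (1 <= b)%nat /\ n = (a * b)%nat /\
    gauge K0 (INR 3) 3 n = (gauge K0 (INR 3) 3 a + gauge K0 (INR 3) 3 b)%Z /\
    y = branch k a b r.
Proof.
  intros Hn Hd Ex Hst (a' & b' & ca & cb & r & Eab & Ha & Hb & Hc & ->) Hy.
  rewrite INR_3, div_pow3 in Ex.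
  destruct (st_eq_mul_inv ca cb a' b') as [Sa Sb]; auto; [rewrite Hc, <- Eab; auto|].
  destruct (stle_factor _ _ Ha) as (a & i & Ha1 & Had & ->).
  destruct (stle_factor _ _ Hb) as (b & j & Hb1 & Hbd & ->).
  assert (E : INR (a * b) * p3 (i + j) = INR n * p3 (- Z.of_nat k))
    by (rewrite <- Ex, Eab, mult_INR, p3_add; ring).
  apply pow3_factor_unique in E; auto using not_divide3_mul. destruct E as [<- Hij].
  assert (Ga : st_eq (ca + 3 * - i) (INR a)).
  { apply (st_eq_shift (- i)) in Sa. rewrite Rmult_assoc, (Rmult_comm (p3 i)), p3_opp, Rmult_1_r in Sa; auto. }
  assert (Gb : st_eq (cb + 3 * - j) (INR b)).
  { apply (st_eq_shift (- j)) in Sb. rewrite Rmult_assoc, (Rmult_comm (p3 j)), p3_opp, Rmult_1_r in Sb; auto. }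
  assert (Gn : st_eq (c - 1 + 3 * Z.of_nat k) (INR (a * b))).
  { apply (st_eq_shift (Z.of_nat k)) in Hst. rewrite Ex, Rmult_assoc, p3_opp, Rmult_1_r in Hst; auto. }
  assert (Ey : INR b * p3 j * (INR a * p3 i + p3 (- r)) = INR b * (INR a + p3 (- (r + i))) * p3 (- Z.of_nat k)).
  { rewrite <- Hij. replace (p3 (- r)) with (p3 (- (r + i)) * p3 i).
    - rewrite p3_add; ring.
    - rewrite <- p3_add; f_equal; lia. }
  (* A spike allows any integer exponent, a branch only a natural one. Since b >= 1, a distance from
     x below 3 ^ (- k) forces the exponent to be positive. *)
  assert (Hr : (0 < r + i)%Z).
  { rewrite Ey, Ex, mult_INR in Hy. pose proof (p3_pos (- Z.of_nat k)). pose proof (p3_pos (- (r + i))).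
    apply (le_INR 1) in Hb1; simpl in Hb1.
    assert (Hlt : p3 (- (r + i)) < p3 0).
    { rewrite p3_0. apply Rmult_lt_reg_r with (p3 (- Z.of_nat k)); auto.
      assert (p3 (- (r + i)) * p3 (- Z.of_nat k) <= INR b * (p3 (- (r + i)) * p3 (- Z.of_nat k))).
      { assert (0 < p3 (- (r + i)) * p3 (- Z.of_nat k)) by (apply Rmult_lt_0_compat; auto). nra. }
      lra. }
    apply p3_lt_inv in Hlt; lia. }
  exists a, b, (Z.to_nat (r + i)); repeat split; auto.
  - rewrite (gauge_K0 _ _ Hn Gn), (gauge_K0 _ _ Ha1 Ga), (gauge_K0 _ _ Hb1 Gb); lia.
  - rewrite branch_eq, Ey, Z2Nat.id by lia; auto.
Qed.

(** Additivity of the gauge leaves exactly one unit of cost for the extra digit: [stle_add_p3]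
    spends it on the factor a, and multiplying by b adds nothing further. *)
Lemma branch_eventually c k a b X : (1 <= a)%nat -> (1 <= b)%nat ->
  st_eq (c - 1) (INR (a * b) * p3 (- Z.of_nat k)) ->
  gauge K0 (INR 3) 3 (a * b) = (gauge K0 (INR 3) 3 a + gauge K0 (INR 3) 3 b)%Z ->
  INR (a * b) * p3 (- Z.of_nat k) < X ->
  exists R0 : nat, forall r : nat, (R0 <= r)%nat ->
    stle c (branch k a b r) /\ INR (a * b) * p3 (- Z.of_nat k) < branch k a b r < X.
Proof.
  intros Ha Hb Hst Hg HX.
  destruct (st_eq_INR_exists a Ha) as [ca Ga], (st_eq_INR_exists b Hb) as [cb Gb].
  assert (Gn : st_eq (c - 1 + 3 * Z.of_nat k) (INR (a * b))).
  { apply (st_eq_shift (Z.of_nat k)) in Hst. rewrite Rmult_assoc, p3_opp, Rmult_1_r in Hst; auto. }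
  assert (Hab : (1 <= a * b)%nat) by nia.
  rewrite (gauge_K0 _ _ Hab Gn), (gauge_K0 _ _ Ha Ga), (gauge_K0 _ _ Hb Gb) in Hg.
  destruct (stle_add_p3 _ _ (proj1 Ga)) as [r0 Hr0].
  assert (Hb' : 0 < INR b * p3 (- Z.of_nat k))
    by (apply Rmult_lt_0_compat; [apply (lt_INR 0); lia|apply p3_pos]).
  destruct (p3_small ((X - INR (a * b) * p3 (- Z.of_nat k)) / (INR b * p3 (- Z.of_nat k)))) as [K HK].
  { apply Rdiv_lt_0_compat; lra. }
  apply lt_div_elim in HK; auto.
  exists (r0 + K)%nat; intros r Hr.
  assert (Hle : p3 (- Z.of_nat r) <= p3 (- Z.of_nat K)) by (apply p3_le; lia).
  pose proof (p3_pos (- Z.of_nat r)).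
  rewrite branch_eq; split.
  - replace c with (cb + (ca + 1) + 3 * - Z.of_nat k)%Z by lia.
    apply stle_shift, stle_mul; [apply Gb|apply Hr0; lia].
  - rewrite mult_INR in *. split; nra.
Qed.

Lemma omega_mul_add_ok a r : ord_ok a -> ord_ok (omega_mul_add a r).
Proof.
  intros [->|H]; [destruct r as [|r]; [left; auto|right; simpl; lia]|].
  destruct a as [|s a]; [simpl in H; lia|right; auto].
Qed.

Lemma cnf_omega_mul_add u a r : cnf u (omega_mul_add a r) = nxt_iter u r (cnf (S u) a).
Proof. destruct a as [|s a]; [destruct r|]; reflexivity. Qed.

Lemma K0_arithmetic : arithmetic_compact K0 3 3.
Proof.
  split; [apply K0_quasi_arithmetic|].
  intros alpha u Hok x n k Hx Hn Hd Ex S1 S2.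
  apply T_layer_at_position in Hx; auto.
  set (X := cnf (S u) alpha). assert (HX : 0 < X) by apply cnf_pos.
  assert (HS1 : forall y, S1 y <-> exists r, y = nxt_iter u (S r) X).
  { intros y; split; intros [r Hr]; exists r.
    - apply T_layer_at_position in Hr; [|apply omega_mul_add_ok; auto].
      unfold cnf_succ in Hr; rewrite cnf_omega_mul_add in Hr; auto.
    - apply T_layer_at_position; [apply omega_mul_add_ok; auto|].
      unfold cnf_succ; rewrite cnf_omega_mul_add; auto. }
  assert (Ex' : x = INR n * p3 (- Z.of_nat k)) by (rewrite Ex, INR_3, div_pow3; auto).
  assert (Hx1 : x = nxt (S u) X) by exact Hx.
  destruct (nxt_spec (S u) X HX) as (Hlev & HxX & _). rewrite <- Hx1 in Hlev, HxX.
  assert (Hst : st_eq (2 - Z.of_nat u - 1) x).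
  { pose proof (nxt_exact (S u) X HX) as H; rewrite <- Hx1 in H.
    replace (2 - Z.of_nat u - 1)%Z with (2 - Z.of_nat (S u))%Z by lia; auto. }
  apply finite_R_or.
  (* The iterates decrease to x, so all but the first [r0] lie in the radius where every point is a
     spike, and within 3 ^ (- k) of x. *)
  - destruct (spike_near _ _ Hst) as (eps & He & Hspike).
    destruct (nxt_iter_below u X (x + Rmin eps (p3 (- Z.of_nat k)))) as [r0 Hr0]; auto.
    { rewrite <- Hx1. pose proof (Rmin_pos _ _ He (p3_pos (- Z.of_nat k))); lra. }
    apply finite_R_incl with (fun y => exists r, (r < r0)%nat /\ y = nxt_iter u (S r) X);
      [|apply (finite_R_image (fun r => nxt_iter u (S r) X))].
    intros y [Hy Hny]. apply HS1 in Hy; destruct Hy as [r Hr]; exists r; split; auto.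
    apply Nat.nle_gt; intros Hle; apply Hny.
    assert (Hy1 : y < x + Rmin eps (p3 (- Z.of_nat k))).
    { subst y; eapply Rle_lt_trans; [apply (nxt_iter_le u r0)|]; auto; lia. }
    assert (Hy2 : x < y) by (subst y; apply nxt_iter_gt; auto).
    pose proof (Rmin_l eps (p3 (- Z.of_nat k))); pose proof (Rmin_r eps (p3 (- Z.of_nat k))).
    destruct (spike_branch (2 - Z.of_nat u) n k x y) as (a & b & s & Hs); auto; [|lra|].
    + apply Hspike; [subst y; apply nxt_iter_level; auto|lra|apply Rabs_def1; lra].
    + exists a, b, s; auto.
  (* There are finitely many factorizations of n. For each admissible one, all but finitely many
     branch points are points of level u strictly between x and X, hence iterates by
     [level_between]. *)
  - apply finite_R_incl with (fun y => exists a, (a <= n)%nat /\ exists b, (b <= n)%nat /\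
      (1 <= a)%nat /\ (1 <= b)%nat /\ n = (a * b)%nat /\
      gauge K0 (INR 3) 3 n = (gauge K0 (INR 3) 3 a + gauge K0 (INR 3) 3 b)%Z /\
      exists r, y = branch k a b r /\ ~ S1 y).
    { intros y [(a & b & r & Ha & Hb & Hab & Hg & Hy) Hny].
      exists a; split; [nia|]. exists b; split; [nia|]. repeat split; auto. exists r; auto. }
    apply finite_R_bounded_union; intros a. apply finite_R_bounded_union; intros b.
    destruct (classic ((1 <= a)%nat /\ (1 <= b)%nat /\ n = (a * b)%nat /\
      gauge K0 (INR 3) 3 n = (gauge K0 (INR 3) 3 a + gauge K0 (INR 3) 3 b)%Z)) as [(Ha & Hb & Hab & Hg)|C].
    + subst n. rewrite Ex' in Hst, HxX.
      destruct (branch_eventually _ k a b X Ha Hb Hst Hg HxX) as [R0 HR0].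
      apply finite_R_incl with (fun y => exists r, (r < R0)%nat /\ y = branch k a b r);
        [|apply (finite_R_image (branch k a b))].
      intros y (_ & _ & _ & _ & r & -> & Hny). exists r; split; auto.
      apply Nat.nle_gt; intros Hle; apply Hny, HS1.
      destruct (HR0 r Hle) as [Hl Hlt]. apply level_between; auto; [|lra].
      rewrite <- Hx1, Ex'; lra.
    + exists []; intros y (H1 & H2 & H3 & H4 & _); apply C; auto.
Qed.

Theorem mainTheorem8 :
  arithmetic_compact K0 3 3 /\
  forall n : nat, (1 <= n)%nat -> gauge K0 (INR 3) 3 n = cpx_st n.
Proof.
  split; [apply K0_arithmetic|].
  intros n Hn; apply gauge_K0; auto using cpx_st_spec.
Qed.
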